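(* Let $p\in\mathbb{C}\setminus\{0\}$ and let $M$ be a nontrivial finite irreducible conformal module over $\mathcal{B}(p)$. (1) If $p\neq-1$, then $M\cong M_{\Delta,\alpha}$ for some $\Delta,\alpha\in\mathbb{C}$ with $\Delta\neq0$. (2) If $p=-1$, then $M\cong M_{\Delta,\alpha,\beta}$ for some $\Delta,\alpha,\beta\in\mathbb{C}$ with $\Delta\neq0$ or $\beta\neq0$.
   Context: $\mathcal{B}(p)$ ($p\in\mathbb{C}$, $p\neq0$) is the Lie conformal algebra which is a free $\mathbb{C}[\partial]$-module with basis $\{L_i\mid i\in\mathbb{Z}_+\}$ ($\mathbb{Z}_+=\{0,1,2,\dots\}$) and $\lambda$-brackets $[L_i\,{}_\lambda\,L_j]=((i+p)\partial+(i+j+2p)\lambda)L_{i+j}$. A conformal module over $\mathcal{B}(p)$ is a $\mathbb{C}[\partial]$-module $M$ with a $\mathbb{C}$-linear $\lambda$-action $\mathcal{B}(p)\otimes M\to\mathbb{C}[\lambda]\otimes M$, $a\otimes v\mapsto a\,{}_\lambda\,v$, with $(\partial a)\,{}_\lambda\,v=-\lambda a\,{}_\lambda\,v$, $a\,{}_\lambda\,(\partial v)=(\partial+\lambda)a\,{}_\lambda\,v$, $[a\,{}_\lambda\,b]\,{}_{\lambda+\mu}\,v=a\,{}_\lambda\,(b\,{}_\mu\,v)-b\,{}_\mu\,(a\,{}_\lambda\,v)$. It is finite if finitely generated over $\mathbb{C}[\partial]$, irreducible if it has no nonzero proper conformal submodules ($\mathbb{C}[\partial]$-submodules stable under the $\lambda$-action),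 and nontrivial if the $\lambda$-action is not identically zero. For $\Delta,\alpha\in\mathbb{C}$, $M_{\Delta,\alpha}=\mathbb{C}[\partial]v$ (free of rank one) is the conformal $\mathcal{B}(p)$-module with $L_0\,{}_\lambda\,v=p(\partial+\Delta\lambda+\alpha)v$ and $L_i\,{}_\lambda\,v=0$ for $i\ge1$. For $p=-1$ and $\Delta,\alpha,\beta\in\mathbb{C}$, $M_{\Delta,\alpha,\beta}=\mathbb{C}[\partial]v$ is the conformal $\mathcal{B}(-1)$-module with $L_0\,{}_\lambda\,v=-(\partial+\Delta\lambda+\alpha)v$, $L_1\,{}_\lambda\,v=\beta v$, and $L_i\,{}_\lambda\,v=0$ for $i\ge2$. *)

(* Defs.v *)
(* The complex numbers are modelled as R[i] = complex R for an
   arbitrary R : realType (any two realTypes are isomorphic, so R[i] is C). *)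
From HB Require Import structures.
From mathcomp Require Import all_boot all_order all_algebra.
From mathcomp.real_closed Require Export complex.
From mathcomp Require Export reals.
Set Implicit Arguments. Unset Strict Implicit. Unset Printing Implicit Defensive.
Import Order.TTheory GRing.Theory Num.Theory.
Local Open Scope ring_scope.

Section ConformalB.
Variable C : fieldType.
Variable p : C.
Variable M : lmodType C.

(* An element of C[lambda] (x) M, given by its coefficient list s
   (s`_k is the coefficient of lambda^k), evaluated at lambda = c. *)
Definition lpoly_eval (s : seq M) (c : C) : M := \sum_(k < size s) c ^+ k *: s`_k.

(* A C[lambda] (x) M - valued lambda-action is recorded through its values at
   lambda = c for all c in C; it must be polynomial in lambda.  Since C is
   infinite, polynomial identities may be checked pointwise. *)
Definition is_lpoly (f : C -> M) : Prop :=
  exists s : seq M, forall c, f c = lpoly_eval s c.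

Definition Clinear (f : M -> M) : Prop :=
  forall (a : C) (u w : M), f (a *: u + w) = a *: f u + f w.

Definition pdel (del : M -> M) (P : {poly C}) (v : M) : M :=
  \sum_(k < size P) P`_k *: iter k del v.

(* (M, del, act) is a conformal module over B(p): del gives the C[del]-module
   structure, act i v c = (L_i _lambda v) at lambda = c.  The lambda-action on
   all of B(p) = (+)_i C[del] L_i is the unique extension by C-linearity and
   (del a)_lambda v = -lambda a_lambda v; the axioms are imposed on the basis.
   Jacobi identity: [L_i _lambda L_j]_{lambda+mu} v, where
   [L_i _lambda L_j] = ((i+p) del + (i+j+2p) lambda) L_{i+j} and del acts as
   -(lambda+mu). *)
Definition is_conf_module (del : M -> M) (act : nat -> M -> C -> M) : Prop :=
  [/\ Clinear del,
      forall i c, Clinear (fun v => act i v c),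
      forall i v, is_lpoly (act i v),
      forall i v c, act i (del v) c = del (act i v c) + c *: act i v c &
      forall (i j : nat) v (l m : C),
        ((i%:R + p) * (- (l + m)) + (i%:R + j%:R + 2%:R * p) * l)
          *: act (i + j)%N v (l + m)
        = act i (act j v m) l - act j (act i v l) m].

Definition conf_finite (del : M -> M) : Prop :=
  exists gens : seq M, forall v, exists Ps : seq {poly C},
    v = \sum_(k < size gens) pdel del Ps`_k gens`_k.

Definition conf_submodule (del : M -> M) (act : nat -> M -> C -> M)
    (S : M -> Prop) : Prop :=
  [/\ S 0, forall a u w, S u -> S w -> S (a *: u + w),
      forall v, S v -> S (del v) &
      forall i v, S v -> exists s : seq M,
        (forall c, act i v c = lpoly_eval s c) /\ (forall k, S s`_k)].

Definition conf_irreducible del act : Prop :=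
  forall S, conf_submodule del act S -> (forall v, S v -> v = 0) \/ (forall v, S v).

Definition conf_nontrivial (act : nat -> M -> C -> M) : Prop :=
  exists i v c, act i v c != 0.

End ConformalB.

Definition conf_iso (C : fieldType) (M N : lmodType C)
    (delM : M -> M) (actM : nat -> M -> C -> M)
    (delN : N -> N) (actN : nat -> N -> C -> N) : Prop :=
  exists f : M -> N,
    [/\ forall (a : C) u w, f (a *: u + w) = a *: f u + f w,
        bijective f,
        forall v, f (delM v) = delN (f v) &
        forall i v c, f (actM i v c) = actN i (f v) c].

(* The rank-one module C[del] v, realised as {poly C} with v = 1 and del acting
   by multiplication by 'X.  L_i _lambda (P(del) v) = P(del+lambda) (L_i _lambda v). *)
Section RankOne.
Variable C : fieldType.

Definition rk1_del (P : {poly C}) : {poly C} := P * 'X.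

(* M_{Delta,alpha} over B(p): L_0 _lambda v = p (del + Delta lambda + alpha) v *)
Definition M_Da_act (p Delta alpha : C) (i : nat) (P : {poly C}) (c : C) : {poly C} :=
  if i == 0%N then p *: ((P \Po ('X + c%:P)) * ('X + (Delta * c + alpha)%:P))
  else 0.

(* M_{Delta,alpha,beta} over B(-1): L_0 _lambda v = -(del + Delta lambda + alpha) v,
   L_1 _lambda v = beta v, L_i _lambda v = 0 for i >= 2 *)
Definition M_Dab_act (Delta alpha beta : C) (i : nat) (P : {poly C}) (c : C) : {poly C} :=
  if i == 0%N then - ((P \Po ('X + c%:P)) * ('X + (Delta * c + alpha)%:P))
  else if i == 1%N then beta *: (P \Po ('X + c%:P))
  else 0.
End RankOne.

(* Main.v *)
(* Write L_i _lambda v = \sum_n lambda^n / n! E_{i,n} v.  The modes E_{i,n} satisfy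
     [E_{i,a}, E_{j,b}] = (a (j + p) - b (i + p)) E_{i+j,a+b-1},  [E_{i,n}, del] = n E_{i,n-1}.
   Irreducibility makes M torsion-free over C[del], so that M has finite rank, and
   conditions "E_{i,n} v = 0 above some level" cut out finite-dimensional spaces.  The
   operator E_{0,0} - p del commutes with everything, hence E_{0,0} = p (del + alpha).

   Some v != 0 is killed by L_j for all large j: choose v killed by E_{0,n}, n >= 2, and an
   eigenvector of E_{0,1}.  Then x = E_{j,0} v satisfies 3 E_{0,2}^2 x = 2 (2j + p) E_{0,3} x.
   By weights x = (del + alpha)^k u with u in a fixed finite-dimensional space and k - j/p
   bounded, and the two sides are 3 p^2 k^4 (..) u and 4 p^2 k^4 (..) u up to lower order
   in k, so u = 0 for large j.

   Let W_s be the space of vectors killed by the E_{i,n} with i + n >= s.  If W_{s+1} != 0 and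
   s >= 2 then W_s != 0: on W_{s+1} the modes with i + n = s commute, and each either has
   nonzero weight for E_{0,1} or is a multiple of [E_{1,0}, E_{i-1,n+1}], hence is nilpotent.
   Hence W_2 != 0, where only E_{0,0}, E_{0,1} and E_{1,0} survive;
   a common eigenvector there generates M. *)
From HB Require Import structures.
Require Import Defs.
From mathcomp Require Import all_boot all_order all_algebra.
From mathcomp Require Import boolp zify ring.
Import GRing.Theory Num.Theory.
Local Open Scope ring_scope.
Set Implicit Arguments. Unset Strict Implicit. Unset Printing Implicit Defensive.


(** * Subspaces, polynomials in an operator, and bounded dimension *)

Section Subspaces.
Variables (C : fieldType) (M : lmodType C).
Implicit Types (S : M -> Prop) (T : {linear M -> M}) (P Q : {poly C}).

Definition subspace S := S 0 /\ forall a u w, S u -> S w -> S (a *: u + w).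

Definition stable (T : M -> M) S := forall v, S v -> S (T v).

Lemma subspaceZ S a u : subspace S -> S u -> S (a *: u).
Proof. by case=> S0 Sl Su; rewrite -[_ *: _]addr0; apply: Sl. Qed.

Lemma subspaceD S u w : subspace S -> S u -> S w -> S (u + w).
Proof. by case=> S0 Sl Su Sw; rewrite -[u]scale1r; apply: Sl. Qed.

Lemma subspace_sum S I (r : seq I) (B : pred I) (F : I -> M) :
  subspace S -> (forall i, B i -> S (F i)) -> S (\sum_(i <- r | B i) F i).
Proof.
move=> subS SF; elim/big_ind: _ => // [|x y Sx Sy]; first by case: subS.
exact: subspaceD.
Qed.

Lemma subspace_iter S T k u : stable T S -> S u -> S (iter k T u).
Proof. by move=> ST Su; elim: k => //= k; apply: ST. Qed.

Lemma subspaceI S S' : subspace S -> subspace S' -> subspace (fun v => S v /\ S' v).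
Proof.
move=> [S0 Sl] [S0' Sl']; split=> [//|a u w [? ?] [? ?]].
by split; [apply: Sl|apply: Sl'].
Qed.

Lemma subspace_eigen T a : subspace (fun v => T v = a *: v).
Proof.
split=> [|b u w Tu Tw]; first by rewrite linear0 scaler0.
by rewrite linearP Tu Tw scalerDr !scalerA mulrC.
Qed.

Lemma pdelE (T : M -> M) P n v :
  (size P <= n)%N -> pdel T P v = \sum_(k < n) P`_k *: iter k T v.
Proof.
move=> sz; rewrite /pdel (big_ord_widen n (fun k => P`_k *: iter k T v)) // big_mkcond.
apply: eq_bigr => k _; case: ltnP => // /(nth_default 0) ->.
by rewrite scale0r.
Qed.

Lemma pdel0 (T : M -> M) v : pdel T 0 v = 0.
Proof. by rewrite (@pdelE _ _ 0) ?big_ord0 ?size_poly0. Qed.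

Lemma pdelP (T : M -> M) a P Q v :
  pdel T (a *: P + Q) v = a *: pdel T P v + pdel T Q v.
Proof.
pose n := maxn (size P) (size Q).
have sP : (size P <= n)%N by rewrite leq_maxl.
have sQ : (size Q <= n)%N by rewrite leq_maxr.
have sPQ : (size (a *: P + Q)%R <= n)%N.
  rewrite (leq_trans (size_polyD _ _)) // geq_max sQ andbT.
  by rewrite (leq_trans (size_scale_leq _ _)).
rewrite (pdelE _ _ sP) (pdelE _ _ sQ) (pdelE _ _ sPQ) scaler_sumr -big_split /=.
by apply: eq_bigr => k _; rewrite coefD coefZ scalerDl scalerA.
Qed.

Lemma pdelD (T : M -> M) P Q v : pdel T (P + Q) v = pdel T P v + pdel T Q v.
Proof. by rewrite -[P]scale1r pdelP !scale1r. Qed.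

Lemma pdelZ (T : M -> M) a P v : pdel T (a *: P) v = a *: pdel T P v.
Proof. by rewrite -[a *: P]addr0 pdelP pdel0 addr0. Qed.

Lemma pdelB (T : M -> M) P Q v : pdel T (P - Q) v = pdel T P v - pdel T Q v.
Proof. by rewrite addrC -(scaleN1r Q) pdelP scaleN1r addrC. Qed.

Lemma pdelC (T : M -> M) a v : pdel T a%:P v = a *: v.
Proof. by rewrite (@pdelE _ _ 1) ?size_polyC ?leq_b1 // big_ord1 coefC. Qed.

Lemma pdel1 (T : M -> M) v : pdel T 1 v = v.
Proof. by rewrite pdelC scale1r. Qed.

Lemma pdel_linear T P : linear (pdel T P).
Proof.
move=> a u w; rewrite /pdel scaler_sumr -big_split /=; apply: eq_bigr => k _.
have -> : iter k T (a *: u + w) = a *: iter k T u + iter k T w.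
  by elim: (val k) => //= l ->; rewrite linearP.
by rewrite scalerDr !scalerA mulrC.
Qed.

HB.instance Definition _ T P := GRing.isLinear.Build C M M _ (pdel T P) (@pdel_linear T P).

Lemma pdel_mulX T P v : pdel T (P * 'X) v = pdel T P (T v).
Proof.
rewrite (@pdelE _ _ (size P).+1) ?size_polyMX_leq //; last first.
  by rewrite (leq_trans (size_polyMleq _ _)) // size_polyX addn2.
rewrite big_ord_recl coefMX /= scale0r add0r.
by apply: eq_bigr => k _; rewrite coefMX /= -iterSr.
Qed.

Lemma pdelX T v : pdel T 'X v = T v.
Proof. by rewrite -['X]mul1r pdel_mulX pdel1. Qed.

Lemma pdel_comm T (A : {linear M -> M}) P v :
  (forall u, A (T u) = T (A u)) -> A (pdel T P v) = pdel T P (A v).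
Proof.
move=> AT; rewrite /pdel linear_sum; apply: eq_bigr => k _.
by rewrite linearZ /=; congr (_ *: _); elim: (val k) => //= l <-.
Qed.

Lemma pdel_commT T P v : T (pdel T P v) = pdel T P (T v).
Proof. exact: pdel_comm. Qed.

Lemma pdelM T P Q v : pdel T (P * Q) v = pdel T P (pdel T Q v).
Proof.
elim/poly_ind: Q v => [|Q c IH] v; first by rewrite mulr0 !pdel0 linear0.
rewrite mulrDr mulrA !pdelD !pdel_mulX IH linearD /=.
by rewrite mulrC mul_polyC pdelZ pdelC linearZ.
Qed.

Lemma pdel_stable T S P v : subspace S -> stable T S -> S v -> S (pdel T P v).
Proof.
move=> subS ST Sv; rewrite /pdel; apply: subspace_sum => // k _.
by apply: subspaceZ => //; apply: subspace_iter.
Qed.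

Lemma pdel_eigen T P a v : T v = a *: v -> pdel T P v = P.[a] *: v.
Proof.
move=> Tv; elim/poly_ind: P => [|P c IH]; first by rewrite pdel0 horner0 scale0r.
by rewrite pdelD pdel_mulX pdelC Tv linearZ /= IH !hornerE scalerA scalerDl mulrC.
Qed.

Lemma pdel_prod_seq_eq0 T (I : eqType) (r : seq I) (F : I -> {poly C}) i v :
  i \in r -> pdel T (F i) v = 0 -> pdel T (\prod_(k <- r) F k) v = 0.
Proof.
by move=> ir Fi; rewrite (big_rem i) //= mulrC pdelM Fi linear0.
Qed.

(* Bounded dimension, phrased so that it passes to arbitrary subsets. *)
Definition fd S := exists N, forall u : nat -> M, (forall i, S (u i)) ->
  exists c : nat -> C, (exists2 i, (i < N)%N & c i != 0) /\ \sum_(i < N) c i *: u i = 0.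

Lemma fd_sub S S' : (forall v, S v -> S' v) -> fd S' -> fd S.
Proof. by move=> SS' [N HN]; exists N => u Su; apply: HN => i; apply/SS'. Qed.

Lemma fd0 S : (forall v, S v -> v = 0) -> fd S.
Proof.
move=> S0; exists 1%N => u Su; exists (fun=> 1); split; first by exists 0%N; rewrite ?oner_eq0.
by rewrite big_ord1 (S0 _ (Su _)) scaler0.
Qed.

(** Stands in for additivity of dimension. Cut a family into [N1] blocks of [N2] vectors, combine
    each block into [S], and take a dependence between these [N1] combinations; a product of nonzero
    coefficients is nonzero. *)
Lemma fd_extension S S' :
    fd S ->
    (exists N, forall u : nat -> M, (forall i, S' (u i)) ->
       exists c : nat -> C, (exists2 i, (i < N)%N & c i != 0) /\ S (\sum_(i < N) c i *: u i)) ->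
  fd S'.
Proof.
case=> N1 fdS [N2 H2]; exists (N1 * N2)%N => u Su.
have [c Hc] : exists c : nat -> nat -> C, forall g,
    (exists2 i, (i < N2)%N & c g i != 0) /\ S (\sum_(i < N2) c g i *: u (g * N2 + i)%N).
  have /choice[c Hc] : forall g, exists c : nat -> C,
    (exists2 i, (i < N2)%N & c i != 0) /\ S (\sum_(i < N2) c i *: u (g * N2 + i)%N).
    by move=> g; apply: (H2 (fun i => u (g * N2 + i)%N)).
  by exists c.
have [b [[g ltg bg] Hb]] := fdS _ (fun g => (Hc g).2).
exists (fun k => b (k %/ N2)%N * c (k %/ N2)%N (k %% N2)%N); split.
  have [[i lti ci] _] := Hc g; exists (g * N2 + i)%N.
    by rewrite (@leq_trans (g.+1 * N2)) ?leq_mul2r ?ltg ?orbT // mulSn addnC ltn_add2r.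
  have N20 : (0 < N2)%N by case: (N2) lti.
  by rewrite divnMDl // divn_small // addn0 modnMDl modn_small // mulf_neq0.
case: (posnP N2) => [N20|N20]; first by rewrite N20 muln0 big_ord0.
rewrite -[RHS]Hb -(big_mkord xpredT (fun k => (b (k %/ N2)%N * c (k %/ N2)%N (k %% N2)%N) *: u k)).
rewrite big_nat_mul big_mkord; apply: eq_bigr => h _; rewrite scaler_sumr mulSn addnC.
rewrite -{1}[(h * N2)%N]add0n big_addn addKn big_mkord; apply: eq_bigr => i _.
by rewrite addnC divnMDl // modnMDl divn_small // modn_small // addn0 scalerA.
Qed.

End Subspaces.


(** * Bases, annihilating polynomials and finite rank *)

Section Basis.
Variables (C : fieldType) (M : lmodType C).
Implicit Types (S : M -> Prop) (T : {linear M -> M}) (P Q : {poly C}).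

Lemma pdel_sum T I (r : seq I) (F : I -> {poly C}) v :
  pdel T (\sum_(i <- r) F i) v = \sum_(i <- r) pdel T (F i) v.
Proof. by elim/big_rec2: _ => [|i x y _ <-]; rewrite ?pdel0 ?pdelD. Qed.

(** Without a basis every independent family in [S] could be lengthened, until its length reaches
    the bound [N]. *)
Lemma fd_basis S : subspace S -> fd S -> exists (l : nat) (y : nat -> M),
  [/\ forall i, S (y i),
      forall c : nat -> C, \sum_(i < l) c i *: y i = 0 -> forall i, (i < l)%N -> c i = 0 &
      forall u, S u -> exists c : nat -> C, u = \sum_(i < l) c i *: y i].
Proof.
move=> subS [N fdS]; apply: contrapT => nobasis.
suff {fdS} /(_ N)[y [Sy indy]] : forall k, exists y : nat -> M, (forall i, S (y i)) /\
    forall c : nat -> C, \sum_(i < k) c i *: y i = 0 -> forall i, (i < k)%N -> c i = 0.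
  have [c [[i ltiN ci] c0]] := fdS y Sy.
  by rewrite (indy c) ?eqxx in ci.
elim=> [|k [y [Sy indy]]].
  by exists (fun=> 0); split=> // _; case: subS.
have [u Su uspan] : exists2 u, S u & forall c : nat -> C, u <> \sum_(i < k) c i *: y i.
  apply: contrapT => H; apply: nobasis; exists k, y; split=> // u Su.
  by apply: contrapT => Hu; apply: H; exists u => // c uc; apply: Hu; exists c.
exists (fun i => if i == k then u else y i); split=> [i|c]; first by case: eqP.
rewrite big_ord_recr /= eqxx (eq_bigr (fun i : 'I_k => c i *: y i)); last first.
  by move=> i _; rewrite ltn_eqF.
move=> c0; have ck : c k = 0.
  apply: contrapT => /eqP ck; apply: (uspan (fun i => - (c k)^-1 * c i)).
  move/eqP: c0; rewrite addrC addr_eq0 => /eqP/(congr1 (fun x => (c k)^-1 *: x)).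
  rewrite scalerK // => ->; rewrite scalerN -scaleNr scaler_sumr.
  by apply: eq_bigr => i _; rewrite scalerA.
rewrite ck scale0r addr0 in c0 => i; rewrite ltnS leq_eqVlt => /predU1P[->//|].
exact: indy.
Qed.

(** The iterates of [T] on one vector are dependent, which gives a polynomial for each basis vector;
    their product kills all of [S]. *)
Lemma fd_annihilator S T : subspace S -> stable T S -> fd S ->
  exists2 f : {poly C}, f != 0 & forall u, S u -> pdel T f u = 0.
Proof.
move=> subS ST fdS.
have ann1 u : S u -> exists2 f : {poly C}, f != 0 & pdel T f u = 0.
  move=> Su; have [N /(_ (fun i => iter i T u))[|c [[i ltiN ci] c0]]] := fdS.
    by move=> i; apply: subspace_iter.
  exists (\poly_(i < N) c i).
    by apply: contraNneq ci => /(congr1 (fun f : {poly C} => f`_i)); rewrite coef_poly ltiN coef0 => ->.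
  rewrite (pdelE _ _ (size_poly _ _)) -[RHS]c0; apply: eq_bigr => k _.
  by rewrite coef_poly ltn_ord.
have [l [y [Sy _ spany]]] := fd_basis subS fdS.
have /choice[F HF] i : exists f : {poly C}, f != 0 /\ pdel T f (y i) = 0.
  by have [f] := ann1 _ (Sy i); exists f.
exists (\prod_(i <- iota 0 l) F i).
  rewrite prodf_seq_neq0; apply/allP => i _ /=.
  by case: (HF i).
move=> u /spany[c ->]; rewrite linear_sum big1 // => i _; rewrite linearZ /=.
rewrite (@pdel_prod_seq_eq0 _ _ _ _ _ _ (i : nat)) ?scaler0 //.
  by rewrite mem_iota add0n ltn_ord.
by case: (HF i).
Qed.

(* Padding the coefficient matrix with a zero column makes it square and singular. *)
Lemma conf_finite_rank (d : {linear M -> M}) : conf_finite d ->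
  exists N, forall u : nat -> M, exists P : nat -> {poly C},
    (exists2 i, (i < N)%N & P i != 0) /\ \sum_(i < N) pdel d (P i) (u i) = 0.
Proof.
case=> gens Hg; set n := size gens; exists n.+1 => u.
have /choice[A HA] i : exists Ps : seq {poly C},
  u i = \sum_(k < n) pdel d Ps`_k gens`_k by apply: Hg.
pose B := \matrix_(i < n.+1, k < n.+1) if (k < n)%N then (A i)`_k else 0 : {poly C}.
have /det0P[v v0 vB] : \det B == 0.
  rewrite (expand_det_col B ord_max) big1 // => i _.
  by rewrite mxE ltnn mul0r.
exists (fun i => v 0 (inord i)); split.
  have /rV0Pn[i vi] := v0; exists (i : nat) => //; by rewrite inord_val.
transitivity (\sum_(i < n.+1) \sum_(k < n) pdel d (v 0 i * (A i)`_k) gens`_k).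
  apply: eq_bigr => i _; rewrite HA linear_sum inord_val /=.
  by apply: eq_bigr => k _; rewrite -pdelM.
rewrite exchange_big big1 //= => k _; rewrite -pdel_sum.
rewrite -[RHS](pdel0 d gens`_k); congr (pdel d _ _).
have := congr1 (fun w : 'rV_n.+1 => w 0 (widen_ord (leqnSn n) k)) vB.
rewrite mxE [RHS]mxE => E; rewrite -[RHS]E; apply: eq_bigr => i _.
by rewrite mxE /= ltn_ord.
Qed.

End Basis.

(** * Polynomial dependence on a natural number *)

Section CharacteristicZero.
Variables (C : numFieldType) (M : lmodType C).
Implicit Types (S : M -> Prop) (T : {linear M -> M}) (P Q : {poly C}).

(** In characteristic zero a scalar equals at most one natural number. This is how exceptional
    values of an integer parameter are avoided from some point on. *)
Lemma natr_seq_bounded (rs : seq C) : exists N, forall n : nat, n%:R \in rs -> (n < N)%N.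
Proof.
elim: rs => [|r rs [N HN]]; first by exists 0%N.
have [[m rm]|nor] := EM (exists m : nat, r = m%:R).
  exists (maxn m.+1 N) => n; rewrite in_cons rm eqr_nat => /orP[/eqP->|/HN]; lia.
exists N => n; rewrite in_cons => /orP[/eqP rn|/HN//].
by case: nor; exists n.
Qed.

(** The Vandermonde matrix at the nodes 0, ..., n - 1 is invertible, so each coefficient is a
    combination of values at these nodes. *)
Lemma vpoly_eq0 n (a : nat -> M) :
  (forall c : C, \sum_(k < n) c ^+ k *: a k = 0) -> forall k, (k < n)%N -> a k = 0.
Proof.
move=> a0 k ltkn.
pose x := \row_(i < n) (i%:R : C); pose V := Vandermonde n x.
have Vu : V \in unitmx.
  rewrite unitmxE unitfE det_Vandermonde; apply/prodf_neq0 => i _.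
  apply/prodf_neq0 => j ltij; rewrite !mxE subr_eq0 eqr_nat.
  by rewrite neq_ltn ltij orbT.
pose W := invmx V.
have -> : a k = \sum_(i < n) (V *m W) i (Ordinal ltkn) *: a i.
  rewrite (mulmxV Vu) (bigD1 (Ordinal ltkn)) //= big1 ?mxE ?eqxx ?scale1r ?addr0 // => i ik.
  by rewrite mxE (negPf ik) scale0r.
transitivity (\sum_(j < n) W j (Ordinal ltkn) *: \sum_(i < n) x 0 j ^+ i *: a i).
  under [RHS]eq_bigr do rewrite scaler_sumr.
  rewrite exchange_big; apply: eq_bigr => i _ /=; rewrite mxE scaler_suml.
  by apply: eq_bigr => j _; rewrite !mxE scalerA mulrC.
by rewrite big1 // => j _; rewrite mxE a0 scaler0.
Qed.

(** In bases the equation says that a row vector is killed by a polynomial matrix evaluated at [k].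
    As [c0] dominates every [c i], the determinant is a nonzero polynomial, so it vanishes at only
    finitely many naturals. The space [S'] is needed because the [O i] may leave [S]. *)
Lemma pencil_injective (q : nat) (c0 : {poly C}) (c : 'I_q -> {poly C})
    (O : 'I_q -> {linear M -> M}) S S' :
    subspace S -> subspace S' -> fd S -> fd S' ->
    (forall u, S u -> S' u) -> (forall i u, S u -> S' (O i u)) ->
    c0 != 0 -> (forall i, size (c i) < size c0)%N ->
  exists K, forall k, (K <= k)%N -> forall u, S u ->
    c0.[k%:R] *: u + \sum_i (c i).[k%:R] *: O i u = 0 -> u = 0.
Proof.
move=> subS subS' fdS fdS' SS' OS c0n0 szc.
have [l [y [Sy indy spany]]] := fd_basis subS fdS.
have [l' [z [Sz indz spanz]]] := fd_basis subS' fdS'.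
have coords (w : 'I_l -> M) : (forall i, S' (w i)) ->
    exists Y : 'M[C]_(l, l'), forall i, w i = \sum_j Y i j *: z j.
  move=> Sw; have /choice[f Hf] i := spanz _ (Sw i).
  exists (\matrix_(i, j) f i j) => i; rewrite Hf.
  by apply: eq_bigr => j _; rewrite mxE.
have [Y HY] := coords (fun i => y i) (fun i => SS' _ (Sy i)).
have /choice[t Ht] r := coords (fun i => O r (y i)) (fun i => OS r _ (Sy i)).
have combine (w : 'I_l -> M) (Z : 'M_(l, l')) (b : 'rV_l) :
    (forall i, w i = \sum_j Z i j *: z j) ->
    \sum_i b 0 i *: w i = \sum_j (b *m Z) 0 j *: z j.
  move=> HZ; under eq_bigr do rewrite HZ scaler_sumr.
  rewrite exchange_big; apply: eq_bigr => j _ /=; rewrite mxE scaler_suml.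
  by apply: eq_bigr => i _; rewrite scalerA.
have rowindz (b : 'rV_l') : \sum_j b 0 j *: z j = 0 -> b = 0.
  move=> b0; apply/rowP => j; rewrite mxE.
  have := indz (fun j => if insub j is Some j' then b 0 j' else 0) _ j (ltn_ord j).
  by rewrite valK; apply; rewrite -[RHS]b0; apply: eq_bigr => i _; rewrite valK.
have rowindy (b : 'rV_l) : \sum_j b 0 j *: y j = 0 -> b = 0.
  move=> b0; apply/rowP => j; rewrite mxE.
  have := indy (fun j => if insub j is Some j' then b 0 j' else 0) _ j (ltn_ord j).
  by rewrite valK; apply; rewrite -[RHS]b0; apply: eq_bigr => i _; rewrite valK.
have Yfree : row_free Y.
  rewrite -kermx_eq0; apply/eqP/row_matrixP => i; rewrite row0; apply: rowindy.
  rewrite (combine _ _ _ HY) (_ : row i _ *m Y = 0); last first.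
    by rewrite -row_mul mulmx_ker row0.
  by rewrite big1 // => j _; rewrite mxE scale0r.
(* [Y] and [t r] hold the coordinates in [S'] of the basis of [S] and of its image under [O r]; a
   right inverse of [Y] makes the matrices square. *)
pose N r := t r *m pinvmx Y.
pose G : 'M[{poly C}]_l := c0%:M + \sum_r c r *: map_mx polyC (N r).
have detG : \det G != 0.
  (* Take an entry of maximal degree in a polynomial kernel vector: the terms in the [c r] have too
     small a degree to cancel its product with [c0]. *)
  apply/det0P => -[w w0 wG].
  have /rV0Pn[j1 wj1] := w0.
  pose j0 := [arg max_(j > j1) size (w 0 j)].
  have maxj0 j : (size (w 0%R j) <= size (w 0%R j0))%N.
    by rewrite /j0; case: arg_maxnP => // i _; apply.
  have wj0 : w 0 j0 != 0.
    by rewrite -size_poly_gt0 (leq_trans _ (maxj0 j1)) // size_poly_gt0.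
  have := congr1 (fun b : 'rV_l => b 0 j0) wG.
  rewrite /G mulmxDr mul_mx_scalar mulmx_sumr mxE [X in X + _]mxE summxE [RHS]mxE.
  move=> /eqP; rewrite addr_eq0 => /eqP Ew.
  have : (size (c0 * w 0 j0)%R < size c0 + size (w 0%R j0) - 1)%N.
    rewrite Ew size_polyN.
    have s1 : (0 < size c0)%N by rewrite size_poly_gt0.
    have s2 : (0 < size (w 0%R j0))%N by rewrite size_poly_gt0.
    apply: (@leq_ltn_trans (size c0 + size (w 0 j0)%R - 2)%N); last by lia.
    apply: (leq_trans (size_sum _ _ _)); apply/bigmax_leqP => r _.
    rewrite -scalemxAr mxE (leq_trans (size_polyMleq _ _)) //.
    have : (size ((w *m map_mx polyC (N r)) 0 j0)%R <= size (w 0 j0)%R)%N.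
      rewrite mxE (leq_trans (size_sum _ _ _)) //; apply/bigmax_leqP => i _.
      rewrite mxE mulrC mul_polyC (leq_trans (size_scale_leq _ _)) //.
    move: (szc r) s1 s2; move: (size (c r)) (size (polyseq ((_ *m _) _ _))).
    by move: (size c0) (size (polyseq (w _ _))) => n1 n2 n3 n4; lia.
  by rewrite size_mul // subn1 ltnn.
have [K HK] : exists K, forall k, (K <= k)%N -> (\det G).[k%:R] != 0.
  have [r HK] : exists r : seq C, forall x, root (\det G) x -> x \in r.
    apply: contrapT => nor.
    suff [r [sr ur rr]] : exists r : seq C,
        [/\ size r = size (\det G), uniq r & all (root (\det G)) r].
      by have := max_poly_roots detG rr ur; rewrite sr ltnn.
    elim: (size _) => [|n [r [<- ur rr]]]; first by exists [::].
    have [x [rx xr]] : exists x, root (\det G) x /\ x \notin r.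
      apply: contrapT => H; apply: nor; exists r => x rx.
      by apply: contrapT => /negP xr; apply: H; exists x.
    by exists (x :: r); rewrite /= xr ur rx rr.
  have [K HK'] := natr_seq_bounded r; exists K => k leKk.
  by apply/negP => /HK/HK'; rewrite ltnNge leKk.
exists K => k /HK {}HK u Su.
have [cu ->] := spany _ Su.
pose b := \row_(i < l) cu i.
have Eb (w : nat -> M) : \sum_(i < l) cu i *: w i = \sum_(i < l) b 0 i *: w i.
  by apply: eq_bigr => i _; rewrite mxE.
rewrite Eb => E.
suff -> : b = 0 by rewrite big1 // => j _; rewrite [X in X *: _]mxE scale0r.
have Gk : map_mx (horner_eval k%:R) G \in unitmx.
  by rewrite unitmxE unitfE det_map_mx.
rewrite -(mulmxK Gk b) [X in X *m _](_ : _ = 0) ?mul0mx //.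
have -> : map_mx (horner_eval k%:R) G = c0.[k%:R]%:M + \sum_r (c r).[k%:R] *: N r.
  apply/matrixP => i j; rewrite [LHS]mxE [G i j]mxE [RHS]mxE /horner_eval hornerD.
  rewrite !summxE horner_sum !mxE hornerMn; congr (_ + _).
  by apply: eq_bigr => r _; rewrite !mxE hornerM hornerC.
have : b *m (c0.[k%:R] *: Y + \sum_r (c r).[k%:R] *: t r) = 0.
  apply: rowindz; rewrite -(combine (fun i => c0.[k%:R] *: y i + \sum_r (c r).[k%:R] *: O r (y i))).
    rewrite -[RHS]E; under eq_bigr do rewrite scalerDr scaler_sumr.
    rewrite big_split exchange_big /= scaler_sumr; congr (_ + _).
      by apply: eq_bigr => i _; rewrite !scalerA mulrC.
    apply: eq_bigr => r _; rewrite linear_sum scaler_sumr.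
    by apply: eq_bigr => i _; rewrite [X in _ = _ *: X]linearZ /= !scalerA mulrC.
  move=> i; rewrite [X in _ + X](eq_bigr
      (fun r => \sum_j (c r).[k%:R] *: (t r i j *: z j))); last first.
    by move=> r _; rewrite Ht scaler_sumr.
  rewrite HY exchange_big scaler_sumr -big_split /=; apply: eq_bigr => j _.
  rewrite !mxE summxE scalerDl scalerA scaler_suml; congr (_ + _).
  by apply: eq_bigr => r _; rewrite mxE scalerA.
move/(congr1 (fun Z => Z *m pinvmx Y)); rewrite mul0mx -mulmxA mulmxDl.
rewrite -scalemxAl mulmxVp // mulmx_suml scalemx1 => <-; congr (_ *m (_ + _)).
by apply: eq_bigr => r _; rewrite -scalemxAl.
Qed.

End CharacteristicZero.


(** * Eigenvectors on spaces of bounded dimension *)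

Section Eigenvectors.
Variables (C : numClosedFieldType) (M : lmodType C).
Implicit Types (S : M -> Prop) (T : {linear M -> M}) (P Q : {poly C}).

(** Write an annihilating polynomial of [v] as f = g (X - a): either g(T) v is an eigenvector for
    [a], or it vanishes and g replaces f. *)
Lemma fd_eigenvector S T v : subspace S -> stable T S -> fd S -> S v -> v != 0 ->
  exists w a, [/\ S w, w != 0 & T w = a *: w].
Proof.
move=> subS ST fdS Sv v0.
have [f f0 fS] := fd_annihilator subS ST fdS.
have {fS} := fS _ Sv; elim: {f}(size f) {-2}f (leqnn (size f)) f0 => [|n IH] f sf f0 fv.
  by rewrite leqn0 size_poly_eq0 (negPf f0) in sf.
have [sf1|sf1] := boolP (size f == 1%N).
  case/size_poly1P: sf1 => c c0 fc; move/eqP: fv.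
  by rewrite fc pdelC scaler_eq0 (negPf c0) (negPf v0).
have [a /factor_theorem[g fE]] := closed_rootP f sf1.
have g0 : g != 0 by apply: contraNneq f0 => g0; rewrite fE g0 mul0r.
have [gv|gv] := eqVneq (pdel T g v) 0.
  apply: (IH g) => //; move: sf; rewrite fE size_Mmonic ?monicXsubC // size_XsubC.
  by rewrite addn2.
exists (pdel T g v), a; split=> //; first exact: pdel_stable.
apply/eqP; rewrite -subr_eq0 -fv fE mulrC pdelM pdelB pdelX pdelC.
by rewrite pdel_commT.
Qed.

(** Eigenvalues on [S] are roots of one polynomial, so an arithmetic progression of step [δ]
    contains a last one. An operator that preserves [S] and raises the [T]-weight by a positive
    multiple of [δ] must then kill [w]. *)
Lemma fd_extremal_eigenvector S T v δ :
  subspace S -> stable T S -> fd S -> S v -> v != 0 -> δ != 0 ->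
  exists w a, [/\ S w, w != 0, T w = a *: w &
    forall k u, S u -> T u = (a + k.+1%:R * δ) *: u -> u = 0].
Proof.
move=> subS ST fdS Sv v0 δ0.
have [f f0 fS] := fd_annihilator subS ST fdS.
have rootf u a : S u -> u != 0 -> T u = a *: u -> root f a.
  move=> Su u0 /(pdel_eigen f); rewrite fS // => /esym/eqP.
  by rewrite scaler_eq0 (negPf u0) orbF.
have [w [a [Sw w0 Tw]]] := fd_eigenvector subS ST fdS Sv v0.
have [rs frs] := closed_field_poly_normal f.
have [N HN] := natr_seq_bounded [seq (z - a) / δ | z <- rs].
have Hk k u : S u -> u != 0 -> T u = (a + k%:R * δ) *: u -> (k < N)%N.
  move=> Su u0 /(rootf _ _ Su u0); rewrite frs rootZ ?lead_coef_eq0 //.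
  rewrite root_prod_XsubC => rs_a; apply: HN; apply/mapP; exists (a + k%:R * δ) => //.
  by rewrite addrC addKr mulfK.
apply: contrapT => nex.
suff : forall n k u, (N - k <= n)%N -> S u -> u != 0 -> T u = (a + k%:R * δ) *: u -> False.
  by move/(_ N 0%N w); apply => //; rewrite ?subn0 // mul0r addr0.
elim=> [|n IH] k u ltk Su u0 Tu; first by have := Hk _ _ Su u0 Tu; lia.
apply: (nex); exists u, (a + k%:R * δ); split=> // m u' Su' Tu'.
apply: contrapT => /eqP u'0; apply: (IH (k + m.+1)%N u') => //; first by lia.
by rewrite Tu' natrD mulrDl addrA.
Qed.

(* [G, f(B)] = c f'(B), so an annihilating polynomial of B yields one of smaller degree. *)
Lemma fd_weyl_eq0 S (G B : {linear M -> M}) c :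
  subspace S -> stable G S -> stable B S -> fd S -> c != 0 ->
  (forall v, S v -> G (B v) - B (G v) = c *: v) -> forall v, S v -> v = 0.
Proof.
move=> subS SG SB fdS c0 comm.
have commf f v : S v -> G (pdel B f v) - pdel B f (G v) = c *: pdel B f^`() v.
  elim/poly_ind: f v => [|f a IH] v Sv.
    by rewrite deriv0 !pdel0 linear0 subr0 scaler0.
  rewrite derivD derivC addr0 derivM derivX mulr1 !pdelD !pdel_mulX !pdelC linearD linearZ /=.
  rewrite opprD addrACA subrr addr0 scalerDr -(IH (B v)); last exact: SB.
  have -> : c *: pdel B f v = pdel B f (G (B v)) - pdel B f (B (G v)).
    by rewrite -linearB comm // linearZ.
  by rewrite addrA subrK.
have [f f0 fS] := fd_annihilator subS SB fdS.
move: {2}(size f) (leqnn (size f)) => n; elim: n f f0 fS => [|n IH] f f0 fS sf.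
  by rewrite leqn0 size_poly_eq0 (negPf f0) in sf.
have [/size_poly1P[a a0 fa] v Sv|sf1] := boolP (size f == 1%N).
  have /eqP := fS v Sv; rewrite fa pdelC scaler_eq0 (negPf a0) /= => /eqP //.
have sf2 : (1 < size f)%N by rewrite ltn_neqAle eq_sym sf1 size_poly_gt0.
have f'0 : f^`() != 0.
  apply: contraNneq f0 => f'0; rewrite -lead_coef_eq0 lead_coefE.
  have := congr1 (fun g : {poly C} => g`_(size f).-2) f'0.
  have -> : (size f).-1 = (size f).-2.+1 by rewrite prednK // -subn1 subn_gt0.
  by rewrite coef_deriv coef0 => /eqP; rewrite mulrn_eq0.
apply: (IH f^`()) => //; last by rewrite -ltnS (leq_trans (lt_size_deriv f0)).
move=> v Sv; have := commf f v Sv; rewrite (fS v) // (fS (G v)); last exact: SG.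
rewrite linear0 subr0.
move/esym/eqP; rewrite scaler_eq0 (negPf c0) /= => /eqP.
exact.
Qed.

End Eigenvectors.


(* [E i n] stands for the annihilation-algebra element [(L_i)_(n)], i.e.
   [L_i _lambda v = \sum_n lambda^n / n! E i n v]. *)
Record mode_module (C : numClosedFieldType) (p : C) (M : lmodType C)
    (d : {linear M -> M}) (E : nat -> nat -> {linear M -> M}) : Prop := ModeModule {
  mode_del : forall i n v, E i n (d v) = d (E i n v) + n%:R *: E i n.-1 v;
  mode_comm : forall i j a b v, E i a (E j b v) = E j b (E i a v) +
    (a%:R * (j%:R + p) - b%:R * (i%:R + p)) *: E (i + j)%N (a + b).-1 v;
  mode_locally_finite : forall i v, exists N, forall n, (N <= n)%N -> E i n v = 0;
  mode_finite : conf_finite d;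
  mode_irreducible : forall S : M -> Prop, subspace S -> stable d S ->
    (forall i n, stable (E i n) S) -> (forall v, S v -> v = 0) \/ (forall v, S v);
  mode_nontrivial : exists i n v, E i n v != 0 }.

(** * Torsion-freeness, filtrations and Schur's lemma *)

Section ModeModule.
Variables (C : numClosedFieldType) (p : C) (M : lmodType C).
Variables (d : {linear M -> M}) (E : nat -> nat -> {linear M -> M}).
Hypothesis MM : mode_module p d E.
Implicit Types (S : M -> Prop) (T : {linear M -> M}) (P Q : {poly C}).

Let Ed := mode_del MM.
Let EE := mode_comm MM.

Lemma mode_iter_del i n v : (forall n', (n < n')%N -> E i n' v = 0) ->
  forall r m, (n + r <= m)%N ->
    E i m (iter r d v) = if m == (n + r)%N then (m ^_ r)%:R *: E i n v else 0.
Proof.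
move=> v0; elim=> [|r IH] m; rewrite ?addn0.
  rewrite leq_eqVlt eq_sym; case: eqP => [->|_] /=; first by rewrite scale1r.
  exact: v0.
rewrite addnS => ltm; rewrite /= Ed !IH; try lia.
rewrite ifN ?linear0 ?add0r; last by lia.
case: m ltm => // m ltm; rewrite eqSS /=; case: eqP => [->|_]; last by rewrite scaler0.
by rewrite scalerA -natrM ffactnS.
Qed.

(** Each commutator with [d] lowers the second index by one. Only the k-fold commutator with d^k
    brings n + k down to n; every other term ends at an index above n, which kills [v]. *)
Lemma mode_pdel_top i n v : (forall n', (n < n')%N -> E i n' v = 0) ->
  forall P k, (size P <= k.+1)%N ->
    E i (n + k)%N (pdel d P v) = (((n + k) ^_ k)%:R * P`_k) *: E i n v.
Proof.
move=> v0 P k szP; rewrite (pdelE _ _ szP) big_ord_recr /= linearD linear_sum big1 /=.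
  by rewrite add0r linearZ /= (mode_iter_del v0) // eqxx scalerA mulrC.
move=> r _; rewrite linearZ /= (mode_iter_del v0); last by rewrite leq_add2l ltnW.
by rewrite eqn_add2l gtn_eqF // scaler0.
Qed.

Lemma mode_max i v n : E i n v != 0 ->
  exists m, E i m v != 0 /\ forall n', (m < n')%N -> E i n' v = 0.
Proof.
move=> nv; have [N HN] := mode_locally_finite MM i v.
have ub m : E i m v != 0 -> (m <= N)%N.
  by move=> mv; rewrite leqNgt; apply: contra mv => /ltnW/HN->.
case: (ex_maxnP (ex_intro (fun m => E i m v != 0) n nv) ub) => m mv maxm.
exists m; split=> // n' ltn; apply/eqP; apply: contraTT ltn => n'v.
by rewrite -leqNgt maxm.
Qed.

(** If m is the largest index with [E i m v] nonzero, the mode of index m + deg P returns [E i m v]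
    times the leading coefficient of [P] and a nonzero falling factorial. *)
Lemma mode_pdel_eq0 i P v : P != 0 -> (forall m, E i m (pdel d P v) = 0) ->
  forall n, E i n v = 0.
Proof.
move=> P0 EP n; apply/eqP; apply: contraT => /mode_max[m [mv maxm]].
have := mode_pdel_top maxm (leqSpred (size P)); rewrite EP => /esym/eqP.
rewrite scaler_eq0 (negPf mv) orbF mulf_eq0 -lead_coefE lead_coef_eq0 (negPf P0) orbF.
by rewrite pnatr_eq0 -leqn0 leqNgt ffact_gt0 leq_addl.
Qed.

Lemma mode_pdel_ker i P v : (forall n, E i n v = 0) -> forall n, E i n (pdel d P v) = 0.
Proof.
move=> v0 n; apply: (@pdel_stable _ _ d (fun w => forall n, E i n w = 0)) => //.
  by split=> [m|a u w u0 w0 m]; rewrite ?linear0 // linearP u0 w0 scaler0 addr0.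
by move=> w w0 m; rewrite Ed !w0 linear0 scaler0 addr0.
Qed.

(** The torsion vectors form a submodule killed by every mode, so by nontriviality it is not all of
    M. *)
Lemma mode_torsion_free P v : P != 0 -> pdel d P v = 0 -> v = 0.
Proof.
pose S w := exists2 Q, Q != 0 & pdel d Q w = 0.
have SE w : S w -> forall i n, E i n w = 0.
  by move=> [Q Q0 Qw] i n; apply: (mode_pdel_eq0 Q0) => m; rewrite Qw linear0.
have subS : subspace S.
  split=> [|a u w [Qu Qu0 Hu] [Qw Qw0 Hw]]; first by exists 1; rewrite ?oner_eq0 ?linear0.
  exists (Qu * Qw); first by rewrite mulf_neq0.
  by rewrite linearP /= {1}mulrC !pdelM Hu Hw !linear0 addr0.
have [||S0|S1] := mode_irreducible MM subS.
- by move=> w [Q Q0 Qw]; exists Q; rewrite // -pdel_commT Qw linear0.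
- by move=> i n w /SE Ew; rewrite Ew; case: subS.
- by move=> P0 Pv; apply: S0; exists P.
have [i [n [w]]] := mode_nontrivial MM.
by rewrite (SE _ (S1 w)) eqxx.
Qed.

Lemma mode_joint_kernel v : (forall i n, E i n v = 0) -> v = 0.
Proof.
move: v; pose S w := forall i n, E i n w = 0.
have [|||//|S1] := @mode_irreducible _ _ _ _ _ MM S.
- by split=> [i n|a u w u0 w0 i n]; rewrite ?linear0 // linearP u0 w0 scaler0 addr0.
- by move=> w w0 i n; rewrite Ed !w0 linear0 scaler0 addr0.
- by move=> i n w w0 j m; rewrite w0 linear0.
have [i [n [w]]] := mode_nontrivial MM.
by rewrite S1 eqxx.
Qed.

(** [J] selects the first indices that are tested and [c] shifts the level. It is used for i = 0 and
    for i <= I with level n, and for all i with level n + i. *)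
Definition filt (J : pred nat) (c : nat -> nat) s v :=
  forall i n, J i -> (s <= n + c i)%N -> E i n v = 0.

Lemma subspace_filt J c s : subspace (filt J c s).
Proof.
split=> [i n _ _|a u w u0 w0 i n Ji les]; first by rewrite linear0.
by rewrite linearP u0 // w0 // scaler0 addr0.
Qed.

(* A C[d]-relation between elements of [filt J c s.+1] has its vector of leading
   coefficients killed by the top modes, so it lands in [filt J c s]. *)
Lemma fd_filt J c : (forall v, filt J c 0 v -> v = 0) -> forall s, fd (filt J c s).
Proof.
move=> filt0; elim=> [|s IH]; first exact: fd0.
apply: (fd_extension IH); have [N HN] := conf_finite_rank (mode_finite MM).
exists N => u Su; have [P [[i1 lti1 Pi1] PU]] := HN u.
pose i0 := [arg max_(i > Ordinal lti1) size (P i)].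
have maxi0 (i : 'I_N) : (size (P i) <= size (P i0))%N.
  by rewrite /i0; case: arg_maxnP => // j _; apply.
have Pi0 : P i0 != 0.
  by rewrite -size_poly_gt0 (leq_trans _ (maxi0 (Ordinal lti1))) // size_poly_gt0.
pose k := (size (P i0)).-1.
exists (fun i => (P i)`_k); split.
  by exists (i0 : nat); rewrite ?ltn_ord // -lead_coefE lead_coef_eq0.
move=> i n Ji; rewrite leq_eqVlt => /orP[/eqP sE|lts]; last first.
  apply: (@subspace_sum _ _ (filt J c s.+1) _ _ _ _ _ _ i n Ji lts) => [|j _].
    exact: subspace_filt.
  exact: (subspaceZ _ (subspace_filt J c s.+1) (Su j)).
have := congr1 (E i (n + k)%N) PU; rewrite linear0 linear_sum.
rewrite (eq_bigr (fun j : 'I_N => ((n + k) ^_ k)%:R *: ((P j)`_k *: E i n (u j)))); last first.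
  move=> j _; rewrite scalerA mode_pdel_top //; last first.
    by rewrite prednK ?size_poly_gt0.
  by move=> n' ltn; apply: Su => //; rewrite sE ltn_add2r.
rewrite -scaler_sumr => /eqP; rewrite scaler_eq0 pnatr_eq0 -leqn0 leqNgt ffact_gt0 leq_addl /=.
by move/eqP => E0; rewrite -[RHS]E0 linear_sum; apply: eq_bigr => j _; rewrite linearZ.
Qed.

(** Otherwise there are C[d]-independent families of any length. The new vector [v] is not killed by
    some [E i1 n1], while the others are chosen in the kernel of all [E i1 m]; applying these to a
    relation shows that the coefficient of [v] is zero. *)
Lemma mode_finite_joint_kernel : exists I, forall v,
  (forall i n, (i <= I)%N -> E i n v = 0) -> v = 0.
Proof.
apply: contrapT => noI; have [N HN] := conf_finite_rank (mode_finite MM).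
suff /(_ N 0%N)[u [_ indu]] : forall k I, exists u : nat -> M,
    (forall j i n, (j < k)%N -> (i <= I)%N -> E i n (u j) = 0) /\
    forall P : nat -> {poly C}, \sum_(j < k) pdel d (P j) (u j) = 0 -> forall j, (j < k)%N -> P j = 0.
  have [P [[j ltj Pj] P0]] := HN u.
  by rewrite indu ?eqxx in Pj.
elim=> [|k IH] I; first by exists (fun=> 0); split=> // _; rewrite linear0.
have [v [vI v0]] : exists v, (forall i n, (i <= I)%N -> E i n v = 0) /\ v <> 0.
  apply: contrapT => nov; apply: noI; exists I => v vI.
  by apply: contrapT => v0; apply: nov; exists v.
have [i1 [n1 Ev]] : exists i n, E i n v <> 0.
  apply: contrapT => noE; apply: v0; apply: mode_joint_kernel => i n.
  by apply: contrapT => Ev; apply: noE; exists i, n.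
have [u [uI indu]] := IH (maxn I i1).
exists (fun j => if j is j'.+1 then u j' else v); split.
  by case=> [|j] i n ltj lei; [apply: vI|apply: uI; rewrite // leq_max lei].
move=> P; rewrite big_ord_recl /= => P0.
have Pu : P 0%N = 0.
  apply/eqP; apply: contraT => P00; case: Ev; apply: (mode_pdel_eq0 P00) => m.
  have := congr1 (E i1 m) P0; rewrite linear0 linearD [X in _ + X]linear_sum big1 /= ?addr0 // => j _ /=.
  by apply: mode_pdel_ker => n; apply: uI; rewrite ?ltn_ord // leq_max leqnn orbT.
rewrite Pu pdel0 add0r in P0; case=> // j ltj.
exact: (indu (fun j => P j.+1)).
Qed.

(* [E 0 0 - p d] is an endomorphism of the irreducible module. *)
Lemma mode_schur : p != 0 -> exists α, forall v, E 0%N 0%N v = p *: (d v + α *: v).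
Proof.
move=> p0; pose D : {linear M -> M} := E 0%N 0%N \- p \*: d.
have DE v : D v = E 0%N 0%N v - p *: d v by [].
have Dd v : D (d v) = d (D v).
  by rewrite !DE Ed mulr0n scale0r addr0 linearB [X in _ = _ - X]linearZ.
have DEE i n v : D (E i n v) = E i n (D v).
  rewrite !DE EE linearB [X in _ = _ - X]linearZ /= Ed scalerDr opprD addrA addrAC.
  rewrite -scaleNr scalerA add0n mulr0n mul0r sub0r add0r; congr (_ + _).
  by rewrite scaleNr mulrC.
(* Local finiteness bounds the level of a vector uniformly only over finitely many first indices,
   hence the restriction to i <= I. The space so obtained is stable under [D] and has bounded
   dimension. *)
have [I HI] := mode_finite_joint_kernel.
have fdI := @fd_filt (fun i => i <= I)%N (fun=> 0%N) _.
have [i [n [v Ev]]] := mode_nontrivial MM.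
have v0 : v != 0 by apply: contraNneq Ev => ->; rewrite linear0.
have [s Ss] : exists s, filt (fun i => i <= I)%N (fun=> 0%N) s v.
  have /choice[N HN] i' := mode_locally_finite MM i' v.
  exists (\max_(i' < I.+1) N i') => i' n' lei' les; apply: HN; rewrite addn0 in les.
  exact: leq_trans (leq_bigmax (Ordinal (lei' : i' < I.+1)%N)) les.
have [||w [a [Sw w0 Dw]]] := @fd_eigenvector _ _ _ D v (subspace_filt _ _ s) _ (fdI _ s) Ss v0.
- by move=> u Su j m jI les; rewrite -DEE Su // linear0.
- by move=> u u0; apply: HI => j m jI; apply: u0.
have [|||S0|S1] := @mode_irreducible _ _ _ _ _ MM (fun u => D u = a *: u).
- exact: subspace_eigen.
- by move=> u Du; rewrite Dd Du linearZ.
- by move=> j m u Du; rewrite DEE Du linearZ.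
- by rewrite (S0 w) ?eqxx in w0.
exists (a / p) => u; rewrite scalerDr scalerA mulrCA divff // mulr1 -S1 DE addrC subrK.
by [].
Qed.

End ModeModule.


(** * Identities between linear combinations, by reflection *)

Section LinearCombinations.
Variables (C : fieldType) (M : lmodType C).

Definition lincomb (a : seq M) (c : nat -> C) : M := \sum_(i < size a) c i *: a`_i.

Lemma lincombD a x y c c' : x = lincomb a c -> y = lincomb a c' ->
  x + y = lincomb a (fun i => c i + c' i).
Proof.
by move=> -> ->; rewrite -big_split; apply: eq_bigr => i _; rewrite scalerDl.
Qed.

Lemma lincombZ a b x c : x = lincomb a c -> b *: x = lincomb a (fun i => b * c i).
Proof.
by move=> ->; rewrite scaler_sumr; apply: eq_bigr => i _; rewrite scalerA.
Qed.

Lemma lincombN a x c : x = lincomb a c -> - x = lincomb a (fun i => - c i).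
Proof.
by move=> ->; rewrite -sumrN; apply: eq_bigr => i _; rewrite scaleNr.
Qed.

Lemma lincomb_nth a k : (k < size a)%N -> a`_k = lincomb a (fun i => (i == k)%:R).
Proof.
move=> ltk; rewrite /lincomb (bigD1 (Ordinal ltk)) //= eqxx scale1r big1 ?addr0 // => i.
by rewrite -val_eqE /= => /negPf ->; rewrite scale0r.
Qed.

(** On a concrete list the [foldr] computes to a conjunction of scalar equations, within reach of
    [ring]. *)
Lemma lincomb_eq a x y c c' : x = lincomb a c -> y = lincomb a c' ->
  foldr (fun i P => c i = c' i /\ P) True (iota 0 (size a)) -> x = y.
Proof.
move=> -> -> H; apply: eq_bigr => i _; congr (_ *: _); move: i.
have : forall r, foldr (fun i P => c i = c' i /\ P) True r -> forall i, i \in r -> c i = c' i.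
  elim=> //= k r IH [ck /IH Hr] i; rewrite in_cons => /predU1P[->//|]; exact: Hr.
by move/(_ _ H) => Hc i; apply: Hc; rewrite mem_iota ltn_ord.
Qed.

End LinearCombinations.

Ltac lincomb_atom a r k :=
  lazymatch goal with |- ?x = _ =>
    lazymatch r with
    | ?y :: ?r' => tryif constr_eq y x then exact: (@lincomb_nth _ _ a k isT)
                   else lincomb_atom a r' (S k)
    end
  end.
Ltac lincomb_reify a :=
  lazymatch goal with
  | |- (_ + _)%R = _ => apply: lincombD; lincomb_reify a
  | |- (- _)%R = _ => apply: lincombN; lincomb_reify a
  | |- (_ *: _)%R = _ => apply: lincombZ; lincomb_reify a
  | |- _ => lincomb_atom a a 0%N
  end.
(* Decides equality of two linear combinations of the vectors in the list [a]. *)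
Ltac lmod_ring a :=
  apply: (@lincomb_eq _ _ a); [lincomb_reify a | lincomb_reify a | rewrite /=; repeat split; ring].

(** * Vanishing of the modes of large first index *)

Section Vanishing.
Variables (C : numClosedFieldType) (p : C) (M : lmodType C).
Variables (d : {linear M -> M}) (E : nat -> nat -> {linear M -> M}).
Hypothesis MM : mode_module p d E.
Hypothesis p0 : p != 0.
Variable α : C.
Hypothesis E00 : forall v, E 0%N 0%N v = p *: (d v + α *: v).
Implicit Types (S : M -> Prop) (T : {linear M -> M}) (P Q : {poly C}).

Let Ed := mode_del MM.
Let EE := mode_comm MM.

(** Since [E 0 0] is p times this operator [X], one gets [H, X] = p X. *)
Definition del_shift v : M := d v + α *: v.

Lemma del_shift_linear : linear del_shift.
Proof.
move=> a u w; rewrite /del_shift linearP !scalerDr !scalerA mulrC addrACA -!addrA.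
by congr (_ + _); rewrite addrCA.
Qed.

HB.instance Definition _ := GRing.isLinear.Build C M M _ del_shift del_shift_linear.

Local Notation X := del_shift.
Local Notation H := (E 0%N 1%N).
Local Notation A := (E 0%N 2%N).
Local Notation B := (E 0%N 3%N).

Lemma mode_shift i n v : E i n (X v) = X (E i n v) + n%:R *: E i n.-1 v.
Proof. by rewrite /del_shift linearD linearZ /= Ed addrAC. Qed.

Lemma E0_shift v : E 0%N 0%N v = p *: X v. Proof. exact: E00. Qed.

Lemma shift_pdel v : X v = pdel d ('X + α%:P) v.
Proof. by rewrite pdelD pdelX pdelC. Qed.

Lemma shift_inj v : X v = 0 -> v = 0.
Proof. by rewrite shift_pdel; apply: (mode_torsion_free MM); rewrite -size_poly_eq0 size_XaddC. Qed.

Lemma iter_shift_linear k : linear (iter k X).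
Proof. by move=> a u w; elim: k => //= k ->; rewrite linearP. Qed.

HB.instance Definition _ k := GRing.isLinear.Build C M M _ (iter k X) (iter_shift_linear k).

Lemma iter_shift_inj k v : iter k X v = 0 -> v = 0.
Proof. by elim: k => //= k IH /shift_inj. Qed.

Lemma H_iter_shift k u : H (iter k X u) = iter k X (H u + (k%:R * p) *: u).
Proof.
elim: k => [|k IH]; first by rewrite mul0r scale0r addr0.
rewrite iterS mode_shift IH [_.-1]/= E0_shift scale1r -!iterS.
rewrite -[p *: _]linearZ_LR -linearD; congr (iter _ _ _).
rewrite -natr1; lmod_ring [:: H u; u].
Qed.

(** By [A, X] = 2 H and [H, X] = p X at most one factor [X] is lost, so X^k comes out in front with
    coefficients polynomial in [k]. *)
Lemma A_iter_shift k u : A (iter k.+1 X u) =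
  iter k X (X (A u) + (2%:R * k.+1%:R) *: H u + (p * k.+1%:R * k%:R) *: u).
Proof.
elim: k => [|k IH].
  by rewrite /= mode_shift mulr0 scale0r addr0 mulr1.
rewrite iterS mode_shift IH [_.-1]/= H_iter_shift -!iterS -[2%:R *: iter _ _ _]linearZ_LR -linearD.
congr (iter _ _ _).
rewrite -!natr1; lmod_ring [:: X (A u); H u; u].
Qed.

(** Here [B, X] = 3 A, so at most two factors [X] are lost. *)
Lemma B_iter_shift k u : B (iter k.+2 X u) =
  iter k X (X (X (B u)) + (3%:R * k.+2%:R) *: X (A u) +
    (3%:R * k.+2%:R * k.+1%:R) *: H u + (p * k.+2%:R * k.+1%:R * k%:R) *: u).
Proof.
elim: k => [|k IH].
  rewrite /= !mode_shift /= linearD linearZ /=.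
  lmod_ring [:: X (X (B u)); X (A u); H u; u].
rewrite iterS mode_shift IH [_.-1]/= A_iter_shift -!iterS -[3%:R *: iter _ _ _]linearZ_LR -linearD.
congr (iter _ _ _).
rewrite -!natr1; lmod_ring [:: X (X (B u)); X (A u); H u; u].
Qed.

Local Notation V := (filt E (pred1 0%N) (fun=> 0%N)).

Lemma filt0E s v : V s v <-> forall n, (s <= n)%N -> E 0%N n v = 0.
Proof.
split=> [Vv n les|Vv i n /eqP ->]; last by rewrite addn0; apply: Vv.
by apply: Vv; rewrite ?addn0.
Qed.

Lemma fd_filt0 s : fd (V s).
Proof.
apply: (fd_filt MM) => v /filt0E/(_ 0%N isT)/eqP.
by rewrite E0_shift scaler_eq0 (negPf p0) => /eqP/shift_inj.
Qed.

Lemma filt0_mono s t v : (s <= t)%N -> V s v -> V t v.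
Proof. by move=> st /filt0E Vv; apply/filt0E => n tn; apply: Vv; apply: leq_trans tn. Qed.

Lemma filt0_shift s v : V s v -> V s.+1 (X v).
Proof.
move=> /filt0E Vv; apply/filt0E => n ltn.
by rewrite mode_shift !Vv; [rewrite linear0 scaler0 addr0|lia|lia].
Qed.

Lemma filt0_iter_shift k s v : V s v -> V (k + s)%N (iter k X v).
Proof. by move=> Vv; elim: k => //= k; apply: filt0_shift. Qed.

Lemma filt0_stable s n : (0 < n)%N -> stable (E 0%N n) (V s).
Proof.
move=> n0 v /filt0E Vv; apply/filt0E => m les.
by rewrite EE !Vv; [rewrite linear0 scaler0 addr0|lia|lia].
Qed.

(** [E 0 m] shifts the weight of [H] by -(m - 1) p, so an eigenvector extremal in the direction -p
    is killed for every m >= 2. *)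
Lemma mode_singular_vector : exists v ω,
  [/\ v != 0, H v = ω *: v & forall m, (1 < m)%N -> E 0%N m v = 0].
Proof.
have [i [n [v Ev]]] := mode_nontrivial MM.
have v0 : v != 0 by apply: contraNneq Ev => ->; rewrite linear0.
have [s Vv] : exists s, V s v.
  have [N HN] := mode_locally_finite MM 0%N v.
  by exists N; apply/filt0E.
have pN0 : - p != 0 by rewrite oppr_eq0.
have [w [ω [Vw w0 Hw ext]]] := fd_extremal_eigenvector (subspace_filt E _ _ s)
  (@filt0_stable s 1 isT) (fd_filt0 s) Vv v0 pN0.
exists w, ω; split=> // -[|[|m]] // _.
apply: (ext m); first exact: filt0_stable.
rewrite EE Hw linearZ /= -scalerDl; congr (_ *: _).
rewrite -!natr1; ring.
Qed.

(** Both sides are X^k applied to a polynomial in [k] with operator coefficients. Cancelling the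
    injective X^k leaves a pencil in [u], with values in [V s.+2] because X X B raises the level by
    two. *)
Lemma pencil_shift e s : exists K, forall k, (K <= k)%N -> forall u, V s u ->
  3%:R *: A (A (iter k.+2 X u)) = (p * (4%:R * k.+2%:R + e)) *: B (iter k.+2 X u) -> u = 0.
Proof.
pose XA : {linear M -> M} := X \o A.
pose XXB : {linear M -> M} := X \o X \o B.
pose O (i : 'I_7) : {linear M -> M} := nth (idfun : {linear M -> M})
  [:: XA \o XA : {linear M -> M}; XA \o H : {linear M -> M}; H \o XA : {linear M -> M};
      H \o H : {linear M -> M}; XA; H; XXB] i.
pose c (i : 'I_7) : {poly C} := nth 0
  [:: Poly [:: 3%:R]; Poly [:: 12%:R; 6%:R]; Poly [:: 6%:R; 6%:R];
      Poly [:: 24%:R; 36%:R; 12%:R];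
      Poly [:: - (p * (42%:R + 6%:R * e)); - (p * (36%:R + 3%:R * e)); - (6%:R * p)];
      (- (p * (18%:R + 3%:R * e))) *: Poly [:: 2%:R; 3%:R; 1];
      Poly [:: - (p * (8%:R + e)); - (4%:R * p)]] i.
(* The coefficient of [u] itself: 3 p^2 (k+2) (k+1)^2 k - p^2 (4 (k+2) + e) (k+2) (k+1) k = - p^2
   (k+2) (k+1) k (k+5+e), of degree four since p is nonzero. *)
pose c0 : {poly C} := - p ^+ 2 *: \prod_(z <- [:: -2%:R; -1; 0; -(5%:R + e)]) ('X - z%:P).
have szc0 : size c0 = 5%N.
  by rewrite size_scale ?oppr_eq0 ?expf_neq0 // size_prod_XsubC.
have [|||||i u Vu|||K HK] := @pencil_injective _ _ 7 c0 c O (V s) (V s.+2).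
- exact: subspace_filt.
- exact: subspace_filt.
- exact: fd_filt0.
- exact: fd_filt0.
- by move=> u; apply: filt0_mono; lia.
- have VA t w : V t w -> V t.+1 (X (A w)) by move=> Vw; apply/filt0_shift/filt0_stable.
  have VH t w : V t w -> V t (H w) by move=> Vw; apply: filt0_stable.
  have VS t w : V t w -> V t.+1 w by apply: filt0_mono.
  case: i => -[|[|[|[|[|[|[|]]]]]]] //= lti; rewrite /O /=; do ?by auto.
  by apply/filt0_shift/filt0_shift/filt0_stable.
- by rewrite -size_poly_eq0 szc0.
- move=> i; rewrite szc0 ltnS.
  have szP a r : (size r < 5)%N -> (size (a *: Poly r : {poly C}) <= 4)%N.
    by move=> szr; rewrite (leq_trans (size_scale_leq _ _)) // (leq_trans (size_Poly _)).
  case: i => -[|[|[|[|[|[|[|]]]]]]] // lti;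
    by [exact: (szP _ [:: _; _; _]) | rewrite -[c _]scale1r; exact: szP].
exists K => k leK u Vu AB; apply: (HK k leK u Vu).
move: AB; rewrite A_iter_shift A_iter_shift B_iter_shift -![_ *: iter _ _ _]linearZ_LR => /eqP.
rewrite -subr_eq0 -linearB => /eqP/iter_shift_inj AB; rewrite -[RHS]AB.
rewrite /c0 hornerZ horner_prod !big_cons big_nil !hornerXsubC.
set κ : C := k%:R.
have -> : \sum_i (c i).[κ] *: O i u =
    3%:R *: X (A (X (A u))) + ((12%:R + 6%:R * κ) *: X (A (H u)) +
    ((6%:R + 6%:R * κ) *: H (X (A u)) + ((24%:R + 36%:R * κ + 12%:R * κ ^+ 2) *: H (H u) +
    ((- (p * (42%:R + 6%:R * e)) - p * (36%:R + 3%:R * e) * κ - 6%:R * p * κ ^+ 2) *: X (A u) +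
    ((- (p * (18%:R + 3%:R * e)) * (2%:R + 3%:R * κ + κ ^+ 2)) *: H u +
    (- (p * (8%:R + e)) - 4%:R * p * κ) *: X (X (B u))))))).
  rewrite !big_ord_recl big_ord0 addr0 /c /O /= !(hornerZ, horner_cons, hornerC).
  by do !congr (_ *: _ + _); try congr (_ *: _); ring.
have dist (T : {linear M -> M}) v1 v2 v3 b2 b3 :
    T (v1 + b2 *: v2 + b3 *: v3) = T v1 + b2 *: T v2 + b3 *: T v3.
  by rewrite !linearD; congr (_ + _ + _); apply: linearZ_LR.
have distXA v1 v2 v3 b2 b3 :
    X (A (v1 + b2 *: v2 + b3 *: v3)) = X (A v1) + b2 *: X (A v2) + b3 *: X (A v3).
  exact: (dist XA).
have distH v1 v2 v3 b2 b3 : H (v1 + b2 *: v2 + b3 *: v3) = H v1 + b2 *: H v2 + b3 *: H v3.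
  exact: dist.
rewrite distXA distH -!natr1 /κ.
lmod_ring [:: u; X (A (X (A u))); X (A (H u)); H (X (A u)); H (H u); X (A u); H u; X (X (B u))].
Qed.

(** [X] and [d] differ by a scalar, so the finitely many generators over C[d] also generate over
    C[X]; local finiteness puts them in one [V t]. *)
Lemma shift_span : exists t, forall w, exists K (u : nat -> M),
  (forall k, V t (u k)) /\ w = \sum_(k < K) iter k X (u k).
Proof.
have [gens Hg] := mode_finite MM.
have [t Vg] : exists t, forall g, g \in gens -> V t g.
  elim: gens {Hg} => [|g gens [t IH]]; first by exists 0%N.
  have [N HN] := mode_locally_finite MM 0%N g.
  exists (maxn N t) => g'; rewrite in_cons => /predU1P[->|/IH]; last exact/filt0_mono/leq_maxr.
  by apply: (filt0_mono (leq_maxl N t)); apply/filt0E.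
exists t; pose T w := exists K (u : nat -> M),
  (forall k, V t (u k)) /\ w = \sum_(k < K) iter k X (u k).
have subV := subspace_filt E (pred1 0%N) (fun=> 0%N) t.
have V0 : V t 0 by case: subV.
have subT : subspace T.
  split=> [|a x y [K [u [Vu ->]]] [K' [u' [Vu' ->]]]].
    by exists 0%N, (fun=> 0); rewrite big_ord0.
  exists (K + K')%N, (fun k => a *: (if (k < K)%N then u k else 0) + (if (k < K')%N then u' k else 0)).
  split=> [k|]; first by case: subV => _; apply; case: ifP.
  rewrite (big_ord_widen (K + K') (fun k => iter k X (u k))) ?leq_addr //.
  rewrite (big_ord_widen (K + K') (fun k => iter k X (u' k))) ?leq_addl //.
  rewrite !(big_mkcond (fun k : 'I__ => (k < _)%N)) scaler_sumr -big_split.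
  apply: eq_bigr => k _ /=.
  by rewrite linearP; congr (_ *: _ + _); case: ifP => // _; rewrite linear0.
have TX : stable X T.
  move=> w [K [u [Vu ->]]]; exists K.+1, (fun k => if k is k'.+1 then u k' else 0).
  by split=> [[]//|]; rewrite big_ord_recl add0r linear_sum.
have Td : stable d T.
  move=> w Tw; have -> : d w = X w + (- α) *: w by rewrite /del_shift scaleNr addrK.
  by apply: subspaceD; [|exact: TX|exact: subspaceZ].
suff TT w : T w by move=> w; apply: TT.
have [Ps ->] := Hg w; apply: subspace_sum => // k _; apply: pdel_stable => //.
exists 1%N, (fun=> gens`_k); split; last by rewrite big_ord1.
by move=> _; apply/Vg/mem_nth.
Qed.

Lemma pdel_H_iter_shift P k u :
  pdel H P (iter k X u) = iter k X (pdel H (P \Po ('X + (k%:R * p)%:P)) u).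
Proof.
elim/poly_ind: P u => [|P c IH] u; first by rewrite comp_poly0 !pdel0 linear0.
rewrite pdelD pdel_mulX pdelC H_iter_shift IH -[c *: _]linearZ_LR -linearD; congr (iter _ _ _).
rewrite comp_polyD comp_polyM comp_polyX comp_polyC pdelD pdelC pdelM; congr (_ + _).
by rewrite pdelD pdelX pdelC.
Qed.

(* Multiply by the polynomial in [H] that annihilates the unwanted summands. *)
Lemma weight_span t f w h K (u : nat -> M) :
    (forall x, V t x -> pdel H f x = 0) -> (forall k, V t (u k)) ->
    w = \sum_(k < K) iter k X (u k) -> H w = h *: w ->
  exists u' : nat -> M, [/\ forall k, V t (u' k),
    forall k, f.[h - k%:R * p] != 0 -> u' k = 0 &
    w = \sum_(k < K) iter k X (u' k)].
Proof.
move=> fV Vu wE Hw.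
pose bad k := f.[h - k%:R * p] != 0.
(* [H] passes through X^k as H + k p, so the shifted f kills the summand X^k u_k. No factor vanishes
   at [h], so R(h) can be divided out. *)
pose F k : {poly C} := if bad k then f \Po ('X - (k%:R * p)%:P) else 1.
pose R := \prod_(k <- iota 0 K) F k.
have Rh : R.[h] != 0.
  rewrite horner_prod prodf_seq_neq0; apply/allP => k _ /=; rewrite /F.
  by case: ifP => [bk|_]; rewrite ?hornerC ?oner_eq0 // horner_comp !hornerE.
have Rbad k : (k < K)%N -> bad k -> pdel H R (iter k X (u k)) = 0.
  move=> ltk bk; apply: (pdel_prod_seq_eq0 (i := k)); first by rewrite mem_iota.
  rewrite /F bk pdel_H_iter_shift -comp_polyA comp_polyD comp_polyX -polyCN comp_polyC.
  by rewrite polyCN addrK comp_polyXr fV ?linear0.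
have subV := subspace_filt E (pred1 0%N) (fun=> 0%N) t.
exists (fun k => if bad k then 0 else R.[h]^-1 *: pdel H (R \Po ('X + (k%:R * p)%:P)) (u k)).
split=> [k|k bk|].
- case: ifP => _; first by case: subV.
  exact: (subspaceZ _ subV (pdel_stable _ subV (@filt0_stable t 1 isT) (Vu k))).
- by rewrite ifT.
rewrite -[LHS](scalerK Rh) -(pdel_eigen R Hw) {1}wE (linear_sum (pdel H R)) scaler_sumr.
apply: eq_bigr => k _ /=; case: ifP => [bk|_]; first by rewrite Rbad // scaler0 linear0.
by rewrite linearZ /= pdel_H_iter_shift.
Qed.

Lemma mode0_eventually_zero v ω : H v = ω *: v -> (forall m, (1 < m)%N -> E 0%N m v = 0) ->
  exists J, forall j, (J <= j)%N -> E j 0%N v = 0.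
Proof.
move=> Hv sv; have [t span] := shift_span.
have subV := subspace_filt E (pred1 0%N) (fun=> 0%N).
have [f f0 fV] := fd_annihilator (subV t) (@filt0_stable t 1 isT) (fd_filt0 t).
have [rs frs] := closed_field_poly_normal f.
have rootrs x : f.[x] = 0 -> x \in rs.
  by move=> /eqP; rewrite {1}frs -/(root _ x) rootZ ?lead_coef_eq0 // root_prod_XsubC.
(* [a] bounds the gaps between powers of [X] occurring in [w]. Once the lowest power is factored
   out, the remaining vector lies in [V (a + t)], independently of [j]. *)
have [a Ha] := natr_seq_bounded [seq (z' - z) / p | z <- rs, z' <- rs].
(* If z = ω + j + p - k p, then 2 (2 j + p) = p (4 k + e z). *)
pose e z := (4%:R * (z - ω) - 2%:R * p) / p.
have [K HK] : exists K, forall z, z \in rs -> forall k, (K <= k)%N -> forall u, V (a + t)%N u ->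
    3%:R *: A (A (iter k.+2 X u)) = (p * (4%:R * k.+2%:R + e z)) *: B (iter k.+2 X u) -> u = 0.
  have /choice[K HK] z := pencil_shift (e z) (a + t).
  exists (\max_(z <- rs) K z) => z zrs k leK; apply: HK.
  by apply: leq_trans leK; exact: (@leq_bigmax_seq _ rs xpredT K).
(* An exponent k0 < K + 2 would place j = p k0 - ω - p + z0 in this finite list. *)
have [J HJ] := natr_seq_bounded [seq p * k%:R - ω - p + z | z <- rs, k <- iota 0 K.+2].
exists J => j leJ; set w := E j 0%N v.
have Hw : H w = (ω + j%:R + p) *: w.
  rewrite EE Hv linearZ /= add0n -scalerDl; congr (_ *: _).
  by rewrite mul1r mul0r subr0 addrA.
have [L [u0 [Vu0 wE0]]] := span w.
have [u [Vu ubad wE]] := weight_span fV Vu0 wE0 Hw.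
apply: contrapT => /eqP w0.
have exk : exists k, (k < L)%N && (u k != 0).
  apply: contrapT => nok; case/eqP: w0; rewrite wE big1 // => k _.
  have [->|uk] := eqVneq (u k) 0; first by rewrite linear0.
  by case: nok; exists (k : nat); rewrite ltn_ord.
case: (ex_minnP exk) => k0 /andP[ltk0 uk0] mink0.
have good k : u k != 0 -> ω + j%:R + p - k%:R * p \in rs.
  by move=> uk; apply: rootrs; apply/eqP; apply: contraR uk => /ubad ->.
set z0 := ω + j%:R + p - k0%:R * p in good *.
pose u' := \sum_(k < L) (if u k != 0 then iter (k - k0) X (u k) else 0).
have Vu' : V (a + t)%N u'.
  apply: subspace_sum => // k _; case: ifP => [uk|_]; last by case: (subV (a + t)%N).
  have lek : (k0 <= k)%N by apply: mink0; rewrite ltn_ord.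
  apply: (@filt0_mono (k - k0 + t)); last exact: filt0_iter_shift.
  rewrite leq_add2r ltnW //; apply: Ha; apply/allpairsP.
  exists (ω + j%:R + p - k%:R * p, z0); split; rewrite ?good //=.
  by rewrite natrB // /z0; field.
have wE' : w = iter k0 X u'.
  rewrite wE linear_sum; apply: eq_bigr => k _ /=.
  case: eqVneq => [->|uk] /=; first by rewrite !linear0.
  by rewrite -iterD subnKC // mink0 // ltn_ord.
have leK : (K.+2 <= k0)%N.
  rewrite leqNgt; apply/negP => ltK; suff: (j < J)%N by rewrite ltnNge leJ.
  apply: HJ; apply/allpairsP; exists (z0, k0); split; rewrite ?good ?mem_iota //=.
  by rewrite /z0; ring.
have [k k0E leKk] : exists2 k, k0 = k.+2 & (K <= k)%N by exists (k0 - 2)%N; lia.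
case/eqP: w0; rewrite wE'.
suff -> : u' = 0 by rewrite linear0.
apply: (HK z0 _ k) => //; first exact: good.
(* Only the commutator survives on [v], so A (A w) and B w are both multiples of [E j 2 v]. *)
have E0v m n : (1 < m)%N ->
    E 0%N m (E j n v) = (m%:R * (j%:R + p) - n%:R * p) *: E j (m + n).-1 v.
  by move=> m1; rewrite EE sv // linear0 !add0r.
rewrite -k0E -wE' !E0v // linearZ /= E0v // !scalerA; congr (_ *: _).
by rewrite /e /z0; field.
Qed.

(** The bracket of [E 0 n.+2] with [E j 0] is (n + 2) (j + p) times [E j n.+1], so vanishing for n =
    0 spreads to all n; [J'] avoids j = -p. *)
Lemma modes_eventually_zero : exists2 v, v != 0 &
  exists J, forall j n, (J <= j)%N -> E j n v = 0.
Proof.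
have [v [ω [v0 Hv sv]]] := mode_singular_vector; exists v => //.
have [J HJ] := mode0_eventually_zero Hv sv.
have [J' HJ'] := natr_seq_bounded [:: - p].
exists (maxn J J') => j n; rewrite geq_max => /andP[leJ leJ'].
case: n => [|n]; first exact: HJ.
have /eqP := EE 0 j n.+2 0 v; rewrite HJ // sv // !linear0 add0r mul0r subr0 addn0 add0n.
rewrite eq_sym scaler_eq0 mulf_eq0 pnatr_eq0 /= addr_eq0 => /orP[/eqP jp|/eqP //].
suff : (j < J')%N by rewrite ltnNge leJ'.
by apply: HJ'; rewrite jp mem_seq1.
Qed.

End Vanishing.


(** * Descent to level two and a generating eigenvector *)

Section RankOneVector.
Variables (C : numClosedFieldType) (p : C) (M : lmodType C).
Variables (d : {linear M -> M}) (E : nat -> nat -> {linear M -> M}).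
Hypothesis MM : mode_module p d E.
Hypothesis p0 : p != 0.
Variable α : C.
Hypothesis E00 : forall v, E 0%N 0%N v = p *: (d v + α *: v).

Let EE := mode_comm MM.

Local Notation W := (filt E predT id).

Lemma fd_filtT s : fd (W s).
Proof. by apply: (fd_filt MM) => v Wv; apply: (mode_joint_kernel MM) => i n; apply: Wv. Qed.

Lemma filtT_stable s i n : (0 < n + i)%N -> stable (E i n) (W s).
Proof.
move=> ni v Wv j m _ les; rewrite EE !Wv ?linear0 ?scaler0 ?addr0 //.
rewrite /= in les *; lia.
Qed.

(** The modes of level s commute on [W s.+1], their brackets having level at least 2 s - 1 > s. They
    are made to vanish one at a time, from i = s down to 0; [S j] records those with i >= j. *)
Lemma filtT_descend s v : (1 < s)%N -> W s.+1 v -> v != 0 -> exists2 w, W s w & w != 0.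
Proof.
move=> s1 Wv v0.
pose S j w := W s.+1 w /\ forall i n, (j <= i)%N -> (n + i)%N = s -> E i n w = 0.
have subS j : subspace (S j).
  apply: subspaceI; first exact: subspace_filt.
  split=> [i n _ _|a u w u0 w0 i n ji nis]; first by rewrite linear0.
  by rewrite linearP u0 // w0 // scaler0 addr0.
have fdS j : fd (S j) by apply: (fd_sub _ (fd_filtT s.+1)) => w [].
have topW w i n i' n' : W s.+1 w -> (n + i)%N = s -> (n' + i')%N = s ->
    E i n (E i' n' w) = E i' n' (E i n w).
  move=> Ww nis nis'; rewrite EE (Ww (i + i')%N) ?scaler0 ?addr0 //=; lia.
have top_stable j i n : (n + i)%N = s -> stable (E i n) (S j).
  move=> nis w [Ww w0]; split; first by apply: filtT_stable => //; lia.
  by move=> i' n' ji' nis'; rewrite topW // w0 // linear0.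
have H_stable j : stable (E 0%N 1%N) (S j).
  move=> w [Ww w0]; split; first exact: filtT_stable.
  by move=> i n ji nis; rewrite EE addn0 addn1 /= !w0 // linear0 scaler0 addr0.
have G_stable j : stable (E 1%N 0%N) (S j).
  move=> w [Ww w0]; split; first exact: filtT_stable.
  move=> i n ji nis; rewrite EE w0 // linear0 add0r addn0 addn1.
  case: n nis => [|n] nis; first by rewrite !mul0r subrr scale0r.
  by rewrite w0 ?scaler0 //=; lia.
suff: exists2 w, S 0%N w & w != 0.
  case=> w [Ww w0] wn0; exists w => // i n _; rewrite leq_eqVlt => /predU1P[sE|lts].
    exact: w0.
  exact: Ww.
suff: forall k, (k <= s.+1)%N -> exists2 w, S (s.+1 - k)%N w & w != 0.
  by move/(_ s.+1 (leqnn _)); rewrite subnn.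
elim=> [_|k IH ltk].
  by exists v => //; split=> // i n lei nis; lia.
have {IH}[w Sw w0] := IH (ltnW ltk).
set j := (s.+1 - k.+1)%N; have jE : (s.+1 - k)%N = j.+1 by rewrite /j; lia.
have js : (j <= s)%N by rewrite /j; lia.
rewrite jE in Sw; set n := (s - j)%N; have njs : (n + j)%N = s by rewrite /n; lia.
suff [w' [Sw' w'0 Xw']] : exists w', [/\ S j.+1 w', w' != 0 & E j n w' = 0].
  exists w' => //; split; first by case: Sw'.
  move=> i m; rewrite leq_eqVlt => /predU1P[<- mjs|ltj mis]; last by case: Sw' => _; apply.
  by rewrite (_ : m = n) //; lia.
(* The weight of [E j n] under [H]; if it is nonzero, an extremal eigenvector is killed. *)
pose δ := j%:R + p - n%:R * p.
have [δ0|δ0] := eqVneq δ 0; last first.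
  have [w' [a [Sw' w'0 Hw' ext]]] :=
    fd_extremal_eigenvector (subS _) (H_stable j.+1) (fdS _) Sw w0 δ0.
  exists w'; split=> //; apply: (ext 0%N); first exact: top_stable.
  by rewrite EE Hw' linearZ /= -scalerDl; congr (_ *: _); rewrite /δ; ring.
have [w' [β [Sw' w'0 Xw']]] := fd_eigenvector (subS _) (top_stable j.+1 j n njs) (fdS _) Sw w0.
have [β0|β0] := eqVneq β 0; first by exists w'; rewrite Xw' β0 scale0r.
(* Here [E j n] would be a nonzero scalar and, up to scaling, the commutator of
   [E 1 0] with [E j.-1 n.+1]. *)
have p1 : p != -1.
  (* For p = -1 the weight [δ] would be n + j - 1 = s - 1, which is nonzero. *)
  apply: contraTneq s1 => p1; move: δ0; rewrite /δ p1 => /eqP.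
  rewrite (_ : _ - _ = (n + j)%:R - 1) ?natrD; last by ring.
  by rewrite subr_eq0 -natrD njs (eqr_nat _ s 1) => /eqP ->.
have j0 : (0 < j)%N.
  (* For j = 0 the weight [δ] would be p (1 - s), again nonzero. *)
  rewrite lt0n; apply: contraTneq s1 => j0; move: δ0; rewrite /δ -njs j0 addn0 => /eqP.
  rewrite add0r -{1}[p]mul1r -mulrBl mulf_eq0 (negPf p0) orbF subr_eq0 eq_sym.
  by rewrite (eqr_nat _ n 1) => /eqP ->.
pose S' x := S j.+1 x /\ E j n x = β *: x.
have subS' : subspace S' by apply: subspaceI => //; apply: subspace_eigen.
case/eqP: w'0.
apply: (@fd_weyl_eq0 _ _ S' (E 1%N 0%N) (E j.-1 n.+1) (- n.+1%:R * (1 + p) * β)) => //.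
- move=> x [Sx Xx]; split; first exact: G_stable.
  rewrite EE Xx linearZ /= addn0; case: Sx => Wx x0.
  case: (n) njs => [|m] mjs; first by rewrite !mul0r subrr scale0r addr0.
  by rewrite addn1 /= (x0 j.+1) ?scaler0 ?addr0 //; lia.
- have njs' : (n.+1 + j.-1)%N = s by lia.
  move=> x [Sx Xx]; split; first exact: top_stable.
  by rewrite topW // ?Xx ?linearZ //; case: Sx.
- by apply: (fd_sub _ (fdS j.+1)) => x [].
- by rewrite !mulf_neq0 // ?oppr_eq0 ?pnatr_eq0 // addrC addr_eq0.
- move=> x [Sx Xx]; rewrite EE addrC addKr add1n prednK //= Xx scalerA.
  by congr (_ *: _); ring.
Qed.

(* The surviving modes on [filt E predT id 2] are [E 0 0], [E 0 1], [E 1 0]. *)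
Lemma rank_one_vector : exists v ω β, [/\ v != 0, E 0%N 1%N v = ω *: v,
  E 1%N 0%N v = β *: v, forall i n, (1 < n + i)%N -> E i n v = 0 & p != -1 -> β = 0].
Proof.
have [v v0 [J HJ]] := modes_eventually_zero MM p0 E00.
have [s [Wv s1]] : exists s, W s v /\ (1 < s)%N.
  have /choice[N HN] i := mode_locally_finite MM i v.
  (* Only i < J matters: the maximum bounds n, [J] absorbs i in the level n + i, and 2 ensures 1 <
     s. *)
  exists (\max_(i < J) N i + J + 2)%N; split; last by lia.
  move=> i n _ /= les; case: (leqP J i) => [/HJ->//|ltiJ].
  apply: HN; have := leq_bigmax (F := fun i : 'I_J => N i) (Ordinal ltiJ); rewrite /=; lia.
have [u Wu u0] : exists2 u, W 2 u & u != 0.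
  case: s s1 Wv => [|[|s]] // _; elim: s v v0 {HJ} => [|s IH] v v0 Wv; first by exists v.
  by have [w Ww w0] := filtT_descend (isT : 1 < s.+2)%N Wv v0; apply: (IH w).
have subW := subspace_filt E predT id 2.
have HW := @filtT_stable 2 0 1 isT; have GW := @filtT_stable 2 1 0 isT.
have Wout w : W 2 w -> forall i n, (1 < n + i)%N -> E i n w = 0.
  by move=> Ww i n lt1; apply: Ww.
(* [H, E 1 0] = (1 + p) E 1 0. For p = -1 the two operators commute and share an eigenvector;
   otherwise [E 1 0] kills an extremal eigenvector of [H]. *)
have [p1|p1] := eqVneq p (-1).
  have [w [ω [Ww w0 Hw]]] := fd_eigenvector subW HW (fd_filtT 2) Wu u0.
  pose S x := W 2 x /\ E 0%N 1%N x = ω *: x.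
  have subS : subspace S by apply: subspaceI => //; apply: subspace_eigen.
  have GS : stable (E 1%N 0%N) S.
    move=> x [Wx Hx]; split; first exact: GW.
    by rewrite EE Hx linearZ p1 /= subrr mulr0 mul0r subrr scale0r addr0.
  have fdS : fd S by apply: (fd_sub _ (fd_filtT 2)) => x [].
  have [x [β [[Wx Hx] x0 Gx]]] := fd_eigenvector subS GS fdS (conj Ww Hw) w0.
  by exists x, ω, β; split=> //; exact: Wout.
have δ0 : 1 + p != 0 by rewrite addrC addr_eq0.
have [w [ω [Ww w0 Hw ext]]] := fd_extremal_eigenvector subW HW (fd_filtT 2) Wu u0 δ0.
exists w, ω, 0; split=> //; last exact: Wout.
rewrite scale0r; apply: (ext 0%N); first exact: GW.
by rewrite EE Hw linearZ /= -scalerDl; congr (_ *: _); ring.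
Qed.

Lemma cyclic_span w :
    (forall i n, exists P, E i n w = pdel d P w) -> w != 0 -> forall u, exists P, u = pdel d P w.
Proof.
move=> Ew w0; pose S u := exists P, u = pdel d P w.
have subS : subspace S.
  split=> [|a u u' [P ->] [P' ->]]; first by exists 0; rewrite pdel0.
  by exists (a *: P + P'); rewrite pdelP.
have Sd : stable d S by move=> u [P ->]; exists ('X * P); rewrite pdelM pdelX.
have [|S0|//] := mode_irreducible MM subS Sd; last first.
  by case/eqP: w0; apply: S0; exists 1; rewrite pdel1.
suff SE k : forall i n, S (E i n (iter k d w)).
  move=> i n u [P ->]; rewrite /pdel linear_sum; apply: subspace_sum => // k _.
  by rewrite linearZ; apply: (subspaceZ _ subS (SE k i n)).
elim: k => [|k IH] i n; first exact: Ew.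
rewrite /= (mode_del MM); apply: subspaceD => //; first exact: Sd.
exact: (subspaceZ _ subS (IH i n.-1)).
Qed.

(** If both vanish, Q(d) v with Q = X + α generates M, so v = P(d) Q(d) v for some P. But 1 - P Q
    takes the value 1 at -α, against torsion-freeness. *)
Lemma rank_one_nonzero v ω β : v != 0 -> E 0%N 1%N v = ω *: v -> E 1%N 0%N v = β *: v ->
  (forall i n, (1 < n + i)%N -> E i n v = 0) -> ω != 0 \/ β != 0.
Proof.
move=> v0 Hv Gv v2; have [ω0|] := eqVneq ω 0; last by left.
have [β0|] := eqVneq β 0; last by right.
rewrite {}ω0 scale0r in Hv; rewrite {}β0 scale0r in Gv; exfalso.
pose Q : {poly C} := 'X + α%:P; set w := pdel d Q v.
have Q0 : Q != 0 by rewrite -size_poly_eq0 size_XaddC.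
have w0 : w != 0 by apply: contraNneq v0 => /(mode_torsion_free MM Q0) ->.
have Ev0 i n : (0 < n + i)%N -> E i n v = 0.
  by case: i n => [|[|i]] [|[|n]] //= _; apply: v2; lia.
have E00w u : E 0%N 0%N u = pdel d (p *: Q) u by rewrite pdelZ pdelD pdelX pdelC E00.
have Ew i n : E i n w = d (E i n v) + α *: E i n v + n%:R *: E i n.-1 v.
  by rewrite /w pdelD pdelX pdelC linearD linearZ /= (mode_del MM) addrAC.
have [|P vP] := cyclic_span _ w0 v.
  move=> i n; have [ni|] := posnP (n + i)%N.
    by move/eqP: ni; rewrite addn_eq0 => /andP[/eqP-> /eqP->]; exists (p *: Q); apply: E00w.
  move=> ni; rewrite Ew Ev0 // linear0 scaler0 !add0r.
  case: n ni => [|n] ni; first by exists 0; rewrite scale0r pdel0.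
  have [nj|nj] := posnP (n + i)%N; last by exists 0; rewrite Ev0 // scaler0 pdel0.
  move/eqP: nj; rewrite addn_eq0 => /andP[/eqP-> /eqP->] /=.
  by exists p%:P; rewrite pdelC E00w pdelZ scale1r.
have PQ : 1 - P * Q != 0.
  apply/eqP => /(congr1 (fun R : {poly C} => R.[- α])).
  by rewrite !hornerE addNr mulr0 subr0 => /eqP; rewrite oner_eq0.
by case/eqP: v0; apply: (mode_torsion_free MM PQ); rewrite pdelB pdel1 pdelM -/w -vP subrr.
Qed.

End RankOneVector.


(** * Coefficients of vector-valued polynomial functions *)

Section Expansions.
Variables (C : numFieldType) (M : lmodType C).
Implicit Types (f g : C -> M) (c : nat -> M).

(** Coefficients form an eventually zero sequence, so expansions of different lengths can be
    compared and combined. *)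
Definition expands f c := exists N, (forall n, (N <= n)%N -> c n = 0) /\
  forall x, f x = \sum_(n < N) x ^+ n *: c n.

Lemma expandsE c N f D : (forall n, (N <= n)%N -> c n = 0) ->
  (forall x, f x = \sum_(n < N) x ^+ n *: c n) -> (forall n, (D <= n)%N -> c n = 0) ->
  forall x, f x = \sum_(n < D) x ^+ n *: c n.
Proof.
move=> cN fE cD x; rewrite fE.
have sum0 K L : (forall n, (K <= n)%N -> c n = 0) -> (K <= L)%N ->
    \sum_(n < K) x ^+ n *: c n = \sum_(n < L) x ^+ n *: c n.
  move=> cK KL; rewrite (big_ord_widen L (fun n => x ^+ n *: c n)) //.
  rewrite big_mkcond; apply: eq_bigr => n _; case: ltnP => // /cK ->.
  by rewrite scaler0.
by rewrite (sum0 N (N + D)%N) ?leq_addr // (sum0 D (N + D)%N) ?leq_addl.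
Qed.

Lemma expands_unique f c c' : expands f c -> expands f c' -> forall n, c n = c' n.
Proof.
move=> [N [cN fE]] [N' [cN' fE']] n.
pose D := (N + N' + n.+1)%N.
have fD := expandsE (D := D) cN fE _; have fD' := expandsE (D := D) cN' fE' _.
apply/eqP; rewrite -subr_eq0; apply/eqP.
apply: (@vpoly_eq0 _ _ D (fun n => c n - c' n)); last by rewrite /D; lia.
move=> x; under eq_bigr do rewrite scalerBr.
rewrite sumrB -fD -?fD' ?subrr // => m lem; [apply: cN'|apply: cN]; rewrite /D in lem; lia.
Qed.

Lemma expands_eq f g c c' : expands f c -> f =1 g -> c =1 c' -> expands g c'.
Proof.
move=> [N [cN fE]] fg cc'; exists N; split=> [n len|x]; first by rewrite -cc' cN.
by rewrite -fg fE; apply: eq_bigr => n _; rewrite cc'.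
Qed.

Lemma expandsP a f g c c' : expands f c -> expands g c' ->
  expands (fun x => a *: f x + g x) (fun n => a *: c n + c' n).
Proof.
move=> [N [cN fE]] [N' [cN' gE]]; exists (N + N')%N; split=> [n len|x].
  by rewrite cN ?cN' ?scaler0 ?addr0 //; lia.
rewrite (expandsE (D := N + N') cN fE) => [|n len]; last by apply: cN; lia.
rewrite (expandsE (D := N + N') cN' gE) => [|n len]; last by apply: cN'; lia.
rewrite scaler_sumr -big_split; apply: eq_bigr => n _ /=.
by rewrite scalerDr !scalerA mulrC.
Qed.

Lemma expandsZ a f c : expands f c -> expands (fun x => a *: f x) (fun n => a *: c n).
Proof.
move=> [N [cN fE]]; exists N; split=> [n /cN ->|x]; first by rewrite scaler0.
by rewrite fE scaler_sumr; apply: eq_bigr => n _; rewrite !scalerA mulrC.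
Qed.

Lemma expands_linear (T : {linear M -> M}) f c : expands f c ->
  expands (fun x => T (f x)) (fun n => T (c n)).
Proof.
move=> [N [cN fE]]; exists N; split=> [n /cN ->|x]; first by rewrite linear0.
by rewrite fE linear_sum; apply: eq_bigr => n _; rewrite linearZ.
Qed.

Lemma expands_mulX f c : expands f c ->
  expands (fun x => x *: f x) (fun n => if n is n'.+1 then c n' else 0).
Proof.
move=> [N [cN fE]]; exists N.+1; split=> [[//|n] /cN //|x].
rewrite big_ord_recl scaler0 add0r fE scaler_sumr.
by apply: eq_bigr => n _; rewrite scalerA -exprS.
Qed.

(** The expansion of f(x + y), first in x for fixed y, then in y for each power of x, so that
    coefficients can be compared one variable at a time. *)
Lemma expands_taylor f c : expands f c -> exists G : nat -> C -> M,
  (forall y, expands (fun x => f (x + y)) (fun a => G a y)) /\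
  (forall a, expands (G a) (fun b => 'C(a + b, a)%:R *: c (a + b)%N)).
Proof.
move=> [N [cN fE]].
exists (fun a y => \sum_(b < N) y ^+ b *: ('C(a + b, a)%:R *: c (a + b)%N)); split=> [y|a].
  exists N; split=> [a lea|x].
    by rewrite big1 // => b _; rewrite cN ?scaler0 // (leq_trans lea) ?leq_addr.
  rewrite fE; under [RHS]eq_bigr do rewrite scaler_sumr.
  transitivity (\sum_(n < N) \sum_(a < N) \sum_(b < N | (n == a + b :> nat)%N)
      x ^+ a *: (y ^+ b *: ('C(a + b, a)%:R *: c (a + b)%N))).
    apply: eq_bigr => n _; rewrite addrC exprDn scaler_suml.
    rewrite (big_ord_widen N (fun a => (y ^+ (n - a) * x ^+ a *+ 'C(n, a)) *: c n)) //.
    rewrite big_mkcond; apply: eq_bigr => a _; case: ltnP => [lta|gta]; last first.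
      by rewrite big1 // => b /eqP nab; move: gta; rewrite nab; lia.
    have ltb : (n - a < N)%N by rewrite (leq_ltn_trans (leq_subr _ _)).
    rewrite (big_pred1 (Ordinal ltb)) => [|b] /=.
      by rewrite subnKC // !scalerA -mulr_natr; congr (_ *: _); ring.
    by rewrite -val_eqE /=; apply/eqP/eqP; lia.
  rewrite exchange_big; apply: eq_bigr => a _.
  under eq_bigr do rewrite big_mkcond.
  rewrite exchange_big; apply: eq_bigr => b _ /=; rewrite -big_mkcond /=.
  case: (ltnP (a + b) N) => [ltab|geab].
    by rewrite (big_pred1 (Ordinal ltab)).
  by rewrite cN // !scaler0 big1.
by exists N; split=> // b leb; rewrite cN ?scaler0 // (leq_trans leb) ?leq_addl.
Qed.

End Expansions.

(** * From the lambda-action to the modes *)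

Section Modes.
Variables (C : numClosedFieldType) (p : C) (M : lmodType C).
Variables (del : M -> M) (act : nat -> M -> C -> M).
Hypothesis conf : is_conf_module p del act.

(** The bracket relation compares coefficients of l^a m^b in the Jacobi identity, whose scalar
    factor is (j + p) l - (i + p) m. The factorials turn the binomials of (l + m)^n into the
    integers a and b. *)
Lemma conf_modes : exists (d : {linear M -> M}) (E : nat -> nat -> {linear M -> M}),
  [/\ (d : M -> M) = del,
      forall i v, expands (act i v) (fun n => n`!%:R^-1 *: E i n v),
      forall i n v, E i n (d v) = d (E i n v) + n%:R *: E i n.-1 v &
      forall i j a b v, E i a (E j b v) = E j b (E i a v) +
        (a%:R * (j%:R + p) - b%:R * (i%:R + p)) *: E (i + j)%N (a + b).-1 v].
Proof.
have [del_lin act_lin act_poly act_del jacobi] := conf.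
have /choice[coef0 Hc0] (iv : nat * M) : exists c : nat -> M, expands (act iv.1 iv.2) c.
  have [s Hs] := act_poly iv.1 iv.2; exists (fun n => s`_n), (size s).
  by split=> [n|x]; [apply: nth_default | rewrite Hs].
pose coef i n v := coef0 (i, v) n.
have Hc i v : expands (act i v) (fun n => coef i n v) by exact: (Hc0 (i, v)).
have fact_n0 n : n`!%:R != 0 :> C by rewrite pnatr_eq0 -lt0n fact_gt0.
have coef_lin i n : linear (coef i n).
  move=> a u w.
  apply: (expands_unique (Hc i _) (expands_eq (expandsP a (Hc i u) (Hc i w)) _ (frefl _)) n).
  by move=> x; rewrite act_lin.
pose cl i n : {linear M -> M} := HB.pack (coef i n)
  (GRing.isLinear.Build C M M _ (coef i n) (coef_lin i n)).
pose al i x : {linear M -> M} := HB.pack (fun v => act i v x)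
  (GRing.isLinear.Build C M M _ (fun v => act i v x) (act_lin i x)).
pose d : {linear M -> M} := HB.pack del (GRing.isLinear.Build C M M _ del del_lin).
pose E i n : {linear M -> M} := n`!%:R \*: cl i n.
have EcE i n v : E i n v = n`!%:R *: coef i n v by [].
exists d, E; split=> [//|i v|i n v|i j a b v].
- by apply: (expands_eq (Hc i v)) => // n; rewrite EcE scalerK.
- rewrite !EcE; have -> : coef i n (d v) =
      d (coef i n v) + (if n is n'.+1 then coef i n' v else 0).
    rewrite -[d (coef _ _ _)]scale1r; apply: (expands_unique (Hc i _) (expands_eq (expandsP 1
      (expands_linear d (Hc i v)) (expands_mulX (Hc i v))) _ (frefl _)) n).
    by move=> x; rewrite scale1r /= act_del.
  rewrite scalerDr [d (_ *: _)]linearZ_LR; congr (_ + _).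
  by case: n => [|n]; rewrite ?scaler0 ?scale0r // scalerA factS natrM.
set f := act (i + j)%N v; set c := fun n => coef (i + j)%N n v.
have fc : expands f c by apply: Hc.
have [G [Gx Gy]] := expands_taylor fc.
set β := i%:R + p; set γ := j%:R + p.
(* [G'] holds the coefficients after multiplication by l. [step1] compares coefficients of l^k for
   fixed m, then [step2] those of m^b. *)
pose G' k m := if k is k'.+1 then G k' m else 0.
have step1 m k : coef i k (act j v m) - act j (coef i k v) m = γ *: G' k m - (β * m) *: G k m.
  have e1 := expandsP (-1) (expands_linear (al j m) (Hc i v)) (Hc i (act j v m)).
  have e2 := expandsP (- (β * m)) (Gx m) (expandsZ γ (expands_mulX (Gx m))).
  have := expands_unique (expands_eq e1 _ (frefl _)) e2 k.
  rewrite scaleN1r scaleNr addrC [RHS]addrC => -> //.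
  move=> l /=; rewrite scaleN1r [LHS]addrC -(jacobi i j v l m) -/f scalerA -scalerDl.
  by congr (_ *: _); rewrite /β /γ; ring.
pose g k l : M := 'C(k + l, k)%:R *: c (k + l)%N.
have step2 : coef i a (coef j b v) - coef j b (coef i a v) =
    (if a is k.+1 then γ *: g k b else 0) - (if b is l.+1 then β *: g a l else 0).
  have e1 := expandsP (-1) (Hc j (coef i a v)) (expands_linear (cl i a) (Hc j v)).
  have e3 : expands (G' a) (fun l => if a is k.+1 then g k l else 0).
    by rewrite /G'; case: (a) => [|k]; [exists 0%N; split=> // x; rewrite big_ord0|apply: Gy].
  have e2 := expandsP (- β) (expands_mulX (Gy a)) (expandsZ γ e3).
  have := expands_unique (expands_eq e1 _ (frefl _)) e2 b.
  rewrite scaleN1r scaleNr addrC [RHS]addrC => -> //.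
    by case: (a) => [|k]; case: (b) => [|l]; rewrite ?scaler0.
  move=> m /=; rewrite scaleN1r [LHS]addrC step1 [LHS]addrC scalerA -scaleNr -mulNr.
  by [].
have cZ i' n x u : coef i' n (x *: u) = x *: coef i' n u by apply: (linearZ_LR (cl i' n)).
have binf k l : 'C(k + l, k)%:R * (k`!%:R * l`!%:R) = (k + l)`!%:R :> C.
  by rewrite -!natrM -(@bin_fact (k + l) k) ?leq_addr // addKn.
apply/eqP; rewrite addrC -subr_eq !EcE !cZ !scalerA (mulrC b`!%:R) -scalerBr step2 -/(c _).
rewrite scalerBr mulrBl scalerBl; apply/eqP; congr (_ - _).
  case: (a) => [|k]; first by rewrite !mul0r scaler0 scale0r.
  by rewrite addSn /g !scalerA; congr (_ *: _); rewrite -binf factS natrM; ring.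
case: (b) => [|l]; first by rewrite !mul0r scaler0 scale0r.
by rewrite addnS /g !scalerA; congr (_ *: _); rewrite -binf factS natrM; ring.
Qed.

End Modes.


(** * Identification with the rank-one modules *)

Section Classification.
Variables (C : numClosedFieldType) (p : C) (M : lmodType C).
Variables (del : M -> M) (act : nat -> M -> C -> M).
Hypothesis conf : is_conf_module p del act.

Lemma act_pdel i v c (d : {linear M -> M}) : (d : M -> M) = del -> forall P,
  act i (pdel d P v) c = pdel d (P \Po ('X + c%:P)) (act i v c).
Proof.
have [_ act_lin _ act_del _] := conf.
move=> dE P; elim/poly_ind: P v => [|P a IH] v.
  have := act_lin i c (-1) 0 0; rewrite !pdel0 !scaleN1r oppr0 addr0 comp_poly0 pdel0.
  by rewrite addNr.
rewrite comp_polyD comp_polyM comp_polyX comp_polyC !pdelD !pdelC pdel_mulX pdelM.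
rewrite [_ + a *: v]addrC act_lin [RHS]addrC IH pdelD pdelX pdelC; congr (_ + pdel d _ _).
by rewrite dE act_del.
Qed.

Lemma conf_rank_one : p != 0 -> conf_finite del -> conf_irreducible del act ->
  conf_nontrivial act ->
  exists (d : {linear M -> M}) (f : M -> {poly C}) (v : M) (Δ α β : C),
  [/\ (d : M -> M) = del, cancel f (fun P => pdel d P v), cancel (fun P => pdel d P v) f,
      forall i c, act i v c = pdel d (if i == 0%N then p *: ('X + (Δ * c + α)%:P)
                                     else if i == 1%N then β%:P else 0) v &
      (Δ != 0 \/ β != 0) /\ (p != -1 -> β = 0)].
Proof.
move=> p0 fin irr nontriv.
have [d [E [dE expE Ed EE]]] := conf_modes conf.
have E_act i v : (forall n, E i n v = 0) -> forall c, act i v c = 0.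
  move=> Ev c; have [N [_ ->]] := expE i v.
  by rewrite big1 // => n _; rewrite Ev !scaler0.
have MM : mode_module p d E.
  split=> //; first 1 last.
  - by rewrite dE.
  - move=> S subS Sd SE; apply: irr; split; [by case: subS|by case: subS|by rewrite -dE|].
    move=> i v Sv; have [N [_ EN]] := expE i v.
    exists (mkseq (fun n => n`!%:R^-1 *: E i n v) N); split=> [c|k].
      rewrite EN /lpoly_eval size_mkseq; apply: eq_bigr => n _.
      by rewrite nth_mkseq.
    case: (ltnP k N) => [ltk|gek]; last by rewrite nth_default ?size_mkseq //; case: subS.
    by rewrite nth_mkseq //; apply: subspaceZ => //; apply: SE.
  - apply: contrapT => noE; have [i [v [c /eqP]]] := nontriv; apply.
    apply: E_act => n; apply: contrapT => /eqP Ev; apply: noE.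
    by exists i, n, v.
  move=> i v; have [N [HN _]] := expE i v; exists N => n /HN/eqP.
  by rewrite scaler_eq0 invr_eq0 pnatr_eq0 -leqn0 leqNgt fact_gt0 /= => /eqP.
have [α E00] := mode_schur MM p0.
have [v [ω [β [v0 Hv Gv v2 pβ]]]] := rank_one_vector MM p0 E00.
have nz := rank_one_nonzero MM p0 E00 v0 Hv Gv v2.
(* The coefficient of lambda in the action of L_0 on [v] is ω v and has to be p Δ v, hence Δ = ω /
   p. *)
have modes_v i c : act i v c = pdel d (if i == 0%N then p *: ('X + (ω / p * c + α)%:P)
    else if i == 1%N then β%:P else 0) v.
  have [N [EN actE]] := expE i v.
  rewrite (expandsE EN actE (D := 2)) => [|n n2]; last first.
    by rewrite v2 ?scaler0 // (leq_trans n2) ?leq_addr.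
  rewrite !big_ord_recl big_ord0 expr0 expr1 !invr1 !scale1r addr0.
  case: i {EN actE} => [|[|i]] /=.
  - rewrite E00 Hv pdelZ pdelD pdelX pdelC.
    have {1}-> : ω = p * (ω / p) by field.
    rewrite scalerDl !scalerDr !scalerA -addrA; congr (_ + _).
    by rewrite addrC; congr (_ *: _ + _); ring.
  - by rewrite Gv pdelC (v2 1%N 1%N) // scaler0 addr0.
  - by rewrite !v2 ?scaler0 ?addr0 ?pdel0.
have span : forall u, exists P, u = pdel d P v.
  apply: (cyclic_span MM) => // i n; case: i n => [|[|i]] [|[|n]].
  - by exists (p *: ('X + α%:P)); rewrite E00 pdelZ pdelD pdelX pdelC.
  - by exists ω%:P; rewrite Hv pdelC.
  - by exists 0; rewrite v2 ?pdel0.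
  - by exists β%:P; rewrite Gv pdelC.
  - by exists 0; rewrite v2 ?pdel0.
  - by exists 0; rewrite v2 ?pdel0 //; lia.
  - by exists 0; rewrite v2 ?pdel0 //; lia.
  - by exists 0; rewrite v2 ?pdel0 //; lia.
  - by exists 0; rewrite v2 ?pdel0 //; lia.
have /choice[f Hf] := span.
exists d, f, v, (ω / p), α, β; split=> //.
  move=> P; apply/eqP; rewrite -subr_eq0; apply: contraNT v0 => PfP.
  by apply/eqP; apply: (mode_torsion_free MM PfP); rewrite pdelB -Hf subrr.
split=> //; case: nz => [ω0|]; [left|by right].
by rewrite mulf_neq0 ?invr_eq0.
Qed.

End Classification.

Theorem theorem5p1 (R : realType) (p : R[i]) (M : lmodType R[i])
    (del : M -> M) (act : nat -> M -> R[i] -> M) :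
  p != 0 ->
  is_conf_module p del act ->
  conf_finite del ->
  conf_irreducible del act ->
  conf_nontrivial act ->
  (p != -1 ->
     exists Delta alpha : R[i], Delta != 0 /\
       conf_iso del act (@rk1_del R[i]) (M_Da_act p Delta alpha)) /\
  (p = -1 ->
     exists Delta alpha beta : R[i], (Delta != 0 \/ beta != 0) /\
       conf_iso del act (@rk1_del R[i]) (M_Dab_act Delta alpha beta)).
Proof.
move=> p0 conf fin irr nontriv.
have [d [f [v [Δ [α [β [dE fK gK actE [nz pβ]]]]]]]] := conf_rank_one conf p0 fin irr nontriv.
(* One formula serves both families: β = 0 when p differs from -1, and p = -1 supplies the sign. *)
have isoP (actN : nat -> {poly R[i]} -> R[i] -> {poly R[i]}) :
    (forall i P c, actN i P c = (P \Po ('X + c%:P)) *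
       (if i == 0%N then p *: ('X + (Δ * c + α)%:P) else if i == 1%N then β%:P else 0)) ->
    conf_iso del act (@rk1_del R[i]) actN.
  move=> actNE; exists f; split.
  - move=> a u w; apply: (can_inj gK).
    by rewrite pdelP !fK.
  - by exists (fun P => pdel d P v).
  - by move=> u; apply: (can_inj gK); rewrite fK /rk1_del pdel_mulX -pdel_commT fK dE.
  - move=> i u c; apply: (can_inj gK); rewrite fK actNE pdelM -actE.
    by rewrite -(act_pdel conf _ _ _ dE) fK.
split=> p1.
  have β0 := pβ p1; exists Δ, α; split; first by case: nz; rewrite // β0 eqxx.
  apply: isoP => i P c; rewrite /M_Da_act β0; case: i => [|[|i]] /=; rewrite ?mulr0 //.
  by rewrite scalerAr.
exists Δ, α, β; split=> //; apply: isoP => i P c; rewrite /M_Dab_act p1.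
case: i => [|[|i]] /=; rewrite ?mulr0 //; first by rewrite scaleN1r mulrN.
by rewrite mulrC mul_polyC.
Qed.
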